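(* Let $n\ge1$. Then $\Theta_{\mathbb Z^n}=\theta_3^n$; $\Theta_{\mathbb Z^n,P}=0$ for all $P\in\mathrm{Harm}_2(\mathbb R^n)$; there is a linear form $c_1$ on $\mathrm{Harm}_4(\mathbb R^n)$ with $\Theta_{\mathbb Z^n,P}=c_1(P)\,\Delta_8\theta_3^n$ for all $P\in\mathrm{Harm}_4(\mathbb R^n)$; and there is a linear form $c_2$ on $\mathrm{Harm}_6(\mathbb R^n)$ with $\Theta_{\mathbb Z^n,P}=c_2(P)\,\varphi\,\Delta_8\theta_3^n$ for all $P\in\mathrm{Harm}_6(\mathbb R^n)$. Moreover $c_1\neq0$ if and only if $n\ge2$, and $c_2\ne0$ if and only if $n\ge3$.
   Context: $\mathbb Z^n$ is the cubic lattice in $\mathbb R^n$. $\mathrm{Harm}_j(\mathbb R^n)$ is the space of homogeneous harmonic polynomials of degree $j$. With $q=e^{i\pi z}$ ($\operatorname{Im}z>0$): $\theta_2=\sum_{m\in\mathbb Z+1/2}q^{m^2}$, $\theta_3=\sum_{m\in\mathbb Z}q^{m^2}$, $\theta_4=\sum_{m\in\mathbb Z}(-q)^{m^2}$, $\Delta_8=\tfrac1{16}\theta_2^4\theta_4^4$, $\varphi=\theta_4^4-\theta_2^4$. For a polynomial $P$, $\Theta_{\Lambda,P}(z)=\sum_{x\in\Lambda}P(x)q^{\langle x,x\rangle}$ and $\Theta_\Lambda=\Theta_{\Lambda,1}$. *)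

(* Defs.v *)
From Stdlib Require Import Reals ZArith.
From Coquelicot Require Import Coquelicot.
From mathcomp Require Import all_boot all_algebra.
From mathcomp Require Import Rstruct.
From mathcomp Require Import mpoly.

Set Implicit Arguments.
Unset Strict Implicit.
Unset Printing Implicit Defensive.

Definition CCS : CompleteSpace :=
  CompleteNormedModule.CompleteSpace _ C_CompleteNormedModule.

Definition cexp (w : C) : C :=
  (Rmult (exp (Re w)) (cos (Im w)), Rmult (exp (Re w)) (sin (Im w))).

Definition qC (z : C) : C := cexp (Cmult (RtoC PI) (Cmult Ci z)).

(* Real powers of q: q^t := e^{i pi t z} (needed for half-integral squares in theta_2). *)
Definition qpow (z : C) (t : R) : C := cexp (Cmult (RtoC (Rmult PI t)) (Cmult Ci z)).

Definition Cpown (w : C) (k : nat) : C := @pow_n C_Ring w k.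

Definition Zpartial (f : Z -> C) (N : nat) : C :=
  \big[Cplus/(RtoC 0)]_(k < (2 * N).+1) f (Z.sub (Z.of_nat k) (Z.of_nat N)).
Definition Zsum_to (f : Z -> C) (l : C) : Prop :=
  filterlim (Zpartial f) eventually (locally l).
Definition Zsum (f : Z -> C) : C := @Hierarchy.iota CCS (Zsum_to f).

Definition Znpartial (n : nat) (f : ('I_n -> Z) -> C) (N : nat) : C :=
  \big[Cplus/(RtoC 0)]_(k : {ffun 'I_n -> 'I_((2 * N).+1)})
     f (fun i => (Z.sub (Z.of_nat (k i)) (Z.of_nat N))).
Definition Znsum_to (n : nat) (f : ('I_n -> Z) -> C) (l : C) : Prop :=
  filterlim (Znpartial f) eventually (locally l).

Definition theta2 (z : C) : C :=
  Zsum (fun k => qpow z (pow (Rplus (IZR k) (Rinv 2)) 2)).   (* m = k + 1/2 ranges over Z + 1/2 *)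
Definition theta3 (z : C) : C :=
  Zsum (fun m => Cpown (qC z) (Z.abs_nat m ^ 2)).
Definition theta4 (z : C) : C :=
  Zsum (fun m => Cpown (Copp (qC z)) (Z.abs_nat m ^ 2)).

Definition Delta8 (z : C) : C :=
  Cmult (Cinv (RtoC 16)) (Cmult (Cpown (theta2 z) 4) (Cpown (theta4 z) 4)).
Definition varphi (z : C) : C :=
  Cminus (Cpown (theta4 z) 4) (Cpown (theta2 z) 4).

Definition sqnorm (n : nat) (x : 'I_n -> Z) : nat :=
  (\sum_(i < n) (Z.abs_nat (x i)) ^ 2)%N.

Definition thetaZn_term (n : nat) (P : {mpoly R[n]}) (z : C) (x : 'I_n -> Z) : C :=
  Cmult (RtoC (P.@[fun i => IZR (x i)])) (Cpown (qC z) (sqnorm x)).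

Definition laplacian (n : nat) (p : {mpoly R[n]}) : {mpoly R[n]} :=
  (\sum_(i < n) (p^`M(i))^`M(i))%R.
Definition harm (n j : nat) (p : {mpoly R[n]}) : Prop :=
  p \is j.-homog /\ laplacian p = 0%R.

Definition linear_on (n : nat) (H : {mpoly R[n]} -> Prop) (c : {mpoly R[n]} -> R) : Prop :=
  forall (a : R) (P Q : {mpoly R[n]}), H P -> H Q ->
    c (a *: P + Q)%R = Rplus (Rmult a (c P)) (c Q).

(* Main.v *)
(** Separating variables, [Theta_{Z^n,P}] is a combination of products of the
    moments [s_k = sum_m m^k q^(m^2)], where [s_k = 0] for odd [k].  For harmonic
    [P] the coefficients of the even monomials of each shape are proportional, so
    the degree 2, 4 and 6 sums are multiples of [0], [s_4 s_0 - 3 s_2^2] and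
    [s_6 s_0^2 - 15 s_4 s_2 s_0 + 30 s_2^3].

    Since [s_(2j) = (q d/dq)^j theta_3], these are differential polynomials in
    [theta_3].  They are computed in formal power series in [r = q^(1/4)], without
    modular forms: Landen's formulas express the squares of the thetas at [q] by
    the thetas at [q^2]; with ['] for [r d/dr], the Wronskian defect
    [G = theta_2' theta_3 - theta_2 theta_3' - theta_4^4 theta_2 theta_3] then
    satisfies [theta_2 theta_3 G = 2 theta_4^2 G(q^2)], and the defect [X] of the
    Riccati equation of [theta_3'/theta_3] satisfies [X = 4 X(q^2)]; comparing
    orders of vanishing, both are zero. *)

From HB Require Import structures.
Require Import Defs.
From Stdlib Require Import Reals ZArith Lra Lia.
From Coquelicot Require Import Coquelicot.
From mathcomp Require Import all_boot all_algebra.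
From mathcomp Require Import Rstruct.
From mathcomp Require Import mpoly.
From mathcomp Require boolp.
From mathcomp Require ring zify.

Set Implicit Arguments.
Unset Strict Implicit.
Unset Printing Implicit Defensive.

Import GRing.Theory zify.

(** * Formal power series: ring structure, derivation, doubling of the variable *)

Section FormalPowerSeries.
Local Open Scope ring_scope.
Import mathcomp.algebra_tactics.ring.

Variable K : comNzRingType.

(** The doubling equations are solved formally because there they become recursions on coefficients.
    The way back to analysis is evaluation at [r = e^(i pi z / 4)], a ring morphism on the series
    with polynomially bounded coefficients. The derivation itself is never evaluated: it sends a
    moment series to 4 times another moment series, so no sum is differentiated analytically. The
    proportionality of the coefficients comes from transposing the Laplacian: adding up the
    coefficients of [laplacian P] over all monomials of one shape gives a linear relation between
    the shape sums of [P]. One relation in degree 4 and two in degree 6 produce the constants -3 and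
    -15, 30. With these constants the logarithmic derivative of [theta_3], which is not a polynomial
    in the thetas, cancels from the moment combinations. When [n] is too small for the shape with
    the most parts, its sum is empty and the relations make all the shape sums vanish; this is why
    [c1] needs two variables and [c2] three. *)

Record fps := Fps { coefs :> nat -> K }.

Lemma fpsP (f g : fps) : (forall n, f n = g n) -> f = g.
Proof.
by case: f g => [f] [g] /= fg; congr Fps; apply: boolp.funext.
Qed.

HB.instance Definition _ := boolp.gen_eqMixin fps.
HB.instance Definition _ := boolp.gen_choiceMixin fps.

Definition fps_zero := Fps (fun _ => 0).
Definition fps_opp (f : fps) := Fps (fun n => - f n).
Definition fps_add (f g : fps) := Fps (fun n => f n + g n).
Definition fps_one := Fps (fun n => (n == 0)%:R).
Definition fps_mul (f g : fps) :=
  Fps (fun n => \sum_(i < n.+1) f i * g (n - i)%N).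

Lemma fps_addA : associative fps_add.
Proof. by move=> f g h; apply: fpsP => n /=; rewrite addrA. Qed.
Lemma fps_addC : commutative fps_add.
Proof. by move=> f g; apply: fpsP => n /=; rewrite addrC. Qed.
Lemma fps_add0 : left_id fps_zero fps_add.
Proof. by move=> f; apply: fpsP => n /=; rewrite add0r. Qed.
Lemma fps_addN : left_inverse fps_zero fps_opp fps_add.
Proof. by move=> f; apply: fpsP => n /=; rewrite addNr. Qed.

HB.instance Definition _ :=
  GRing.isZmodule.Build fps fps_addA fps_addC fps_add0 fps_addN.

(* Ring laws are transported from polynomials: a coefficient of a product
   depends only on truncations of the factors. *)
Definition fps_agree N (f : fps) (p : {poly K}) :=
  forall n, (n <= N)%N -> f n = p`_n.

Lemma fps_agree_trunc N f : fps_agree N f (\poly_(i < N.+1) f i).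
Proof. by move=> n le_nN; rewrite coef_poly ltnS le_nN. Qed.

Lemma fps_agree_mul N f g p q :
  fps_agree N f p -> fps_agree N g q -> fps_agree N (fps_mul f g) (p * q).
Proof.
move=> fp gq n le_nN; rewrite coefM; apply: eq_bigr => i _.
rewrite fp ?gq //; first exact: leq_trans (leq_subr _ _) le_nN.
by apply: leq_trans le_nN; rewrite -ltnS.
Qed.

Lemma fps_agree_eq f g :
  (forall N, exists p, fps_agree N f p /\ fps_agree N g p) -> f = g.
Proof. by move=> fg; apply: fpsP => n; have [p [-> // ->]] := fg n. Qed.

Lemma fps_mulA : associative fps_mul.
Proof.
move=> f g h; apply: fps_agree_eq => N.
have F := @fps_agree_trunc N f; have G := @fps_agree_trunc N g.
have H := @fps_agree_trunc N h.
exists ((\poly_(i < N.+1) f i) * (\poly_(i < N.+1) g i) *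
        (\poly_(i < N.+1) h i)); split.
  by rewrite -mulrA; do 2![apply: fps_agree_mul => //].
by do 2![apply: fps_agree_mul => //].
Qed.
Lemma fps_mulC : commutative fps_mul.
Proof.
move=> f g; apply: fps_agree_eq => N.
have F := @fps_agree_trunc N f; have G := @fps_agree_trunc N g.
exists ((\poly_(i < N.+1) f i) * (\poly_(i < N.+1) g i)); split.
  exact: fps_agree_mul.
by rewrite mulrC; apply: fps_agree_mul.
Qed.
Lemma fps_mul1 : left_id fps_one fps_mul.
Proof.
move=> f; apply: fpsP => n /=; rewrite big_ord_recl /= subn0 mul1r big1 ?addr0 //.
by move=> i _; rewrite mul0r.
Qed.
Lemma fps_mulDl : left_distributive fps_mul fps_add.
Proof.
move=> f g h; apply: fpsP => n /=; rewrite -big_split /=.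
by apply: eq_bigr => i _; rewrite mulrDl.
Qed.
Lemma fps_1neq0 : fps_one != fps_zero.
Proof.
apply/eqP => /(congr1 (fun f : fps => f 0%N)) /= /eqP.
by rewrite (negbTE (@oner_neq0 K)).
Qed.

HB.instance Definition _ := GRing.Zmodule_isComNzRing.Build fps
  fps_mulA fps_mulC fps_mul1 fps_mulDl fps_1neq0.

Lemma coefs0 n : (0 : fps) n = 0. Proof. by []. Qed.
Lemma coefs1 n : (1 : fps) n = (n == 0%N)%:R. Proof. by []. Qed.
Lemma coefsD (f g : fps) n : (f + g) n = f n + g n. Proof. by []. Qed.
Lemma coefsB (f g : fps) n : (f - g) n = f n - g n. Proof. by []. Qed.
Lemma coefsM (f g : fps) n :
  (f * g) n = \sum_(i < n.+1) f i * g (n - i)%N. Proof. by []. Qed.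
Lemma coefsMn (f : fps) k n : (f *+ k) n = f n *+ k.
Proof. by elim: k => [|k IH]; rewrite ?mulr0n // !mulrS coefsD IH. Qed.
Lemma coefs_nat k n : (k%:R : fps) n = k%:R * (n == 0%N)%:R.
Proof. by rewrite coefsMn coefs1 mulr_natl. Qed.
Lemma coefs_natM k (f : fps) n : (k%:R * f) n = k%:R * f n.
Proof. by rewrite mulr_natl coefsMn mulr_natl. Qed.

Definition fps_ord v (f : fps) := forall k, (k < v)%N -> f k = 0.

(** Only the pair [(v, w)] contributes to the coefficient of index [v + w]. The order arguments
    below read off exactly this coefficient. *)
Lemma fps_ordM v w f g : fps_ord v f -> fps_ord w g ->
  fps_ord (v + w) (f * g) /\ (f * g) (v + w)%N = f v * g w.
Proof.
move=> f0 g0; split=> [k ltk|].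
  rewrite coefsM big1 // => i _.
  have [lti|lei] := ltnP i v; first by rewrite f0 ?mul0r.
  rewrite g0 ?mulr0 //; have := ltn_ord i; lia.
have ltv : (v < (v + w).+1)%N by lia.
rewrite coefsM (bigD1 (Ordinal ltv)) //= addKn big1 ?addr0 // => i nei.
have [lti|lei] := ltnP i v; first by rewrite f0 ?mul0r.
rewrite g0 ?mulr0 //; have := ltn_ord i.
have : (i : nat) != v by apply: contraNneq nei => iv; apply/eqP/val_inj.
lia.
Qed.

(* The derivation [r d/dr]. *)
Definition fps_D (f : fps) := Fps (fun n => n%:R * f n).

Lemma fps_DD f g : fps_D (f + g) = fps_D f + fps_D g.
Proof. by apply: fpsP => n /=; rewrite mulrDr. Qed.
Lemma fps_DN f : fps_D (- f) = - fps_D f.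
Proof. by apply: fpsP => n /=; rewrite mulrN. Qed.
Lemma fps_DB f g : fps_D (f - g) = fps_D f - fps_D g.
Proof. by rewrite fps_DD fps_DN. Qed.
Lemma fps_DM f g : fps_D (f * g) = fps_D f * g + f * fps_D g.
Proof.
apply: fpsP => n; rewrite coefsD !coefsM /= mulr_sumr -big_split /=.
apply: eq_bigr => i _; have lei : (i <= n)%N by rewrite -ltnS.
by rewrite -[X in X%:R * (_ * _)](subnKC lei) natrD; ring.
Qed.
Lemma fps_D_nat k : fps_D k%:R = 0.
Proof.
apply: fpsP => -[|n] /=; first by rewrite mul0r.
by rewrite coefs_nat !mulr0.
Qed.
Lemma fps_DX f k : fps_D (f ^+ k.+1) = k.+1%:R * f ^+ k * fps_D f.
Proof.
elim: k => [|k IH]; first by rewrite expr1 expr0 !mul1r.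
by rewrite exprS fps_DM IH !exprS -[k.+2%:R]natr1; ring.
Qed.

(* The substitution [f(r^2)]. *)
Definition fps_sq (f : fps) := Fps (fun n => if odd n then 0 else f n./2).

Lemma fps_sqD f g : fps_sq (f + g) = fps_sq f + fps_sq g.
Proof. by apply: fpsP => n /=; case: odd; rewrite ?addr0. Qed.
Lemma fps_sqN f : fps_sq (- f) = - fps_sq f.
Proof. by apply: fpsP => n /=; case: odd; rewrite ?oppr0. Qed.
Lemma fps_sqB f g : fps_sq (f - g) = fps_sq f - fps_sq g.
Proof. by rewrite fps_sqD fps_sqN. Qed.
Lemma fps_sq_even f n : fps_sq f n.*2 = f n.
Proof. by rewrite /= odd_double doubleK. Qed.
Lemma fps_sqM f g : fps_sq (f * g) = fps_sq f * fps_sq g.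
Proof.
have even_sum (F : nat -> K) m : (forall k, odd k -> F k = 0) ->
    \sum_(i < m.*2.+1) F i = \sum_(j < m.+1) F j.*2.
  move=> F0; elim: m => [|m IH]; first by rewrite !big_ord1.
  by rewrite doubleS 2!big_ord_recr /= F0 /= ?odd_double // addr0 IH [RHS]big_ord_recr.
apply: fpsP => n; rewrite coefsM -[n]odd_double_half.
case: (boolP (odd n)) => [_|_].
  rewrite big1 /= ?odd_double // => i _.
  have lei : (i <= n./2.*2.+1)%N by rewrite -ltnS.
  rewrite oddB //= odd_double.
  by case: (odd i); rewrite ?mul0r ?mulr0.
rewrite add0n fps_sq_even (even_sum (fun i => fps_sq f i * fps_sq g (n./2.*2 - i)%N)).
  by apply: eq_bigr => i _; rewrite -doubleB !fps_sq_even.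
by move=> k odk /=; rewrite odk mul0r.
Qed.
Lemma fps_sq_nat k : fps_sq k%:R = k%:R.
Proof.
apply: fpsP => -[|[|n]] /=; rewrite !coefs_nat ?mulr0 //.
by case: ifP; rewrite ?mulr0.
Qed.
Lemma fps_sqX f k : fps_sq (f ^+ k) = fps_sq f ^+ k.
Proof. by elim: k => [|k IH]; rewrite ?(fps_sq_nat 1) // !exprS fps_sqM IH. Qed.
Lemma fps_D_sq f : fps_D (fps_sq f) = 2%:R * fps_sq (fps_D f).
Proof.
apply: fpsP => n; rewrite coefs_natM /=; case: ifP => [|/negbT evn]; first by rewrite !mulr0.
by rewrite -{1}(odd_double_half n) (negbTE evn) add0n -mul2n natrM mulrA.
Qed.

(* The inverse is the geometric series in [1 - f]. *)
Lemma fps_inv_exists (f : fps) : f 0%N = 1 -> exists g, f * g = 1.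
Proof.
move=> f0; pose h := 1 - f.
have oh k : fps_ord k (h ^+ k).
  elim: k => [|k IH]; first by move=> j.
  rewrite exprS -add1n; apply: (fps_ordM _ IH).1 => -[|j] // _.
  by rewrite /h coefsB coefs1 f0 subrr.
pose G N := \sum_(k < N.+1) h ^+ k.
have stab n d : G (n + d)%N n = G n n.
  elim: d => [|d IH]; first by rewrite addn0.
  have -> : G (n + d.+1)%N = G (n + d)%N + h ^+ (n + d).+1.
    by rewrite addnS /G big_ord_recr.
  rewrite coefsD IH oh ?addr0 //; lia.
exists (Fps (fun n => G n n)); apply: fpsP => n.
transitivity ((f * G n) n).
  rewrite !coefsM; apply: eq_bigr => i _ /=; congr (_ * _).
  by have := stab (n - i)%N i; rewrite subnK // -ltnS.
have -> : f * G n = 1 - h ^+ n.+1.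
  have -> : f = 1 - h by rewrite /h; ring.
  by rewrite -[1 in RHS](expr1n _ n.+1) subrXX; congr (_ * _);
     apply: eq_bigr => i _; rewrite expr1n mul1r.
by rewrite coefsB oh ?subr0.
Qed.

End FormalPowerSeries.

(** * Cancellation in power series over a domain *)

Section FpsDomain.
Local Open Scope ring_scope.
Variable K : idomainType.

(** Once [g] vanishes below [n], the coefficient of [f * g] at [v + n] is [f v * g n], so the
    coefficients of [g] vanish one after another. *)
Lemma fps_mulf_eq0 v (f g : fps K) :
  fps_ord v f -> f v != 0 -> f * g = 0 -> g = 0.
Proof.
move=> of_ fv fg; apply: fpsP => n; elim/ltn_ind: n => n IH.
have [_] := fps_ordM of_ IH; rewrite fg coefs0 => /esym/eqP.
by rewrite mulf_eq0 (negbTE fv) => /eqP.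
Qed.

Lemma fps_mulfI v (f g h : fps K) :
  fps_ord v f -> f v != 0 -> f * g = f * h -> g = h.
Proof.
move=> of_ fv /eqP; rewrite -subr_eq0 -mulrBr => /eqP /(fps_mulf_eq0 of_ fv).
by move/eqP; rewrite subr_eq0 => /eqP.
Qed.

End FpsDomain.

(** * Theta series in [r = q^(1/4)] and Landen's formulas *)

Section ThetaSeries.
Local Open Scope ring_scope.
Import mathcomp.algebra_tactics.ring.

Definition zrange N : seq int := [seq (k%:Z - N%:Z) | k <- iota 0 (2 * N).+1].

Lemma zrange_uniq N : uniq (zrange N).
Proof. by rewrite map_inj_uniq ?iota_uniq // => i j /addIr []. Qed.

Lemma mem_zrange N x : (x \in zrange N) = (`|x| <= N)%N.
Proof.
apply/mapP/idP => [[k]|lexN]; first by rewrite mem_iota => ltk ->; lia.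
by exists (absz (x + N%:Z)); [rewrite mem_iota; lia | lia].
Qed.

(** The reindexing tool for truncated sums: [h] may move the windows [s1], [s2], as long as it
    matches the terms selected by the predicates. *)
Lemma eq_big_bij (V : zmodType) (T1 T2 : eqType) (s1 : seq T1) (s2 : seq T2)
    (P1 : pred T1) (P2 : pred T2) (F1 : T1 -> V) (F2 : T2 -> V) (h : T1 -> T2) :
  uniq s1 -> uniq s2 -> injective h ->
  (forall x, x \in s1 -> P1 x -> [/\ h x \in s2, P2 (h x) & F1 x = F2 (h x)]) ->
  (forall y, y \in s2 -> P2 y -> exists x, [/\ x \in s1, P1 x & h x = y]) ->
  \sum_(x <- s1 | P1 x) F1 x = \sum_(y <- s2 | P2 y) F2 y.
Proof.
move=> u1 u2 hI h12 h21; rewrite -[RHS]big_filter.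
suff pm : perm_eq (map h (filter P1 s1)) (filter P2 s2).
  rewrite -(perm_big _ pm) big_map big_filter [LHS]big_seq_cond [RHS]big_seq_cond.
  by apply: eq_bigr => x /andP[xs Px]; have [] := h12 x xs Px.
apply: uniq_perm; rewrite ?map_inj_uniq ?filter_uniq // => y.
rewrite mem_filter; apply/mapP/andP => [[x]|[Py ys]].
  by rewrite mem_filter => /andP[Px xs] ->; have [] := h12 x xs Px.
by have [x [xs Px hx]] := h21 y ys Py; exists x; rewrite // mem_filter Px.
Qed.

Variable K : numDomainType.
Implicit Types (w : int -> K) (e : int -> nat).

(* The series [sum_x w x r^(e x)]; the truncation of the inner sum is
   harmless as soon as [|x| <= e x]. *)
Definition theta_fps w e : fps K :=
  Fps (fun n => \sum_(x <- zrange n | e x == n) w x).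

Definition proper_exp e := forall x, (`|x| <= e x)%N.

Lemma theta_fps_coef w e n N : proper_exp e -> (n <= N)%N ->
  theta_fps w e n = \sum_(x <- zrange N | e x == n) w x.
Proof.
move=> pe lenN; apply: (eq_big_bij (h := id)); rewrite ?zrange_uniq //.
  by move=> x; rewrite !mem_zrange => lex ex; split=> //; lia.
move=> x _ /eqP ex; exists x; rewrite mem_zrange -ex; split=> //; exact: pe.
Qed.

(** The convolution index is forced to be [e x], so it can be summed away. What remains is a sum
    over lattice pairs of given total exponent, on which linear substitutions act. *)
Lemma theta_fps_mul w e w' e' n : proper_exp e -> proper_exp e' ->
  (theta_fps w e * theta_fps w' e') n =
  \sum_(p <- [seq (x, y) | x <- zrange n, y <- zrange n] | (e p.1 + e' p.2 == n)%N)
    w p.1 * w' p.2.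
Proof.
move=> pe pe'; rewrite coefsM [RHS]big_mkcond [RHS]big_allpairs.
transitivity (\sum_(i < n.+1) \sum_(x <- zrange n) \sum_(y <- zrange n)
    (if (e x == i) && (e' y == n - i)%N then w x * w' y else 0)).
  apply: eq_bigr => i _; have lei : (i <= n)%N by rewrite -ltnS.
  rewrite (theta_fps_coef w pe lei) (theta_fps_coef w' pe' (leq_subr i n)).
  rewrite big_mkcond [X in _ * X]big_mkcond big_distrlr /=.
  apply: eq_bigr => x _; apply: eq_bigr => y _.
  by case: (e x == i); case: (e' y == _); rewrite ?mul0r ?mulr0.
rewrite exchange_big /=; apply: eq_bigr => x _.
rewrite exchange_big /=; apply: eq_bigr => y _.
case: eqP => [exy|nexy].
  have lt : (e x < n.+1)%N by lia.
  rewrite (bigD1 (Ordinal lt)) //= eqxx -{1}exy addKn eqxx /= big1 ?addr0 // => i nei.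
  by case: eqP => //= exi; move: nei; rewrite -val_eqE /= -exi eqxx.
rewrite big1 // => i _; case: ifP => // /andP[/eqP ex /eqP ey].
by have := ltn_ord i; lia.
Qed.

Lemma fps_sq_theta w e : proper_exp e ->
  fps_sq (theta_fps w e) = theta_fps w (fun x => 2 * e x)%N.
Proof.
move=> pe; apply: fpsP => n.
have pe2 : proper_exp (fun x => 2 * e x)%N by move=> x; have := pe x; lia.
rewrite -[n]odd_double_half; case: (odd n).
  by rewrite /= odd_double [RHS]big_pred0 // => x; lia.
rewrite fps_sq_even (theta_fps_coef w pe (leq_addr n./2 n./2)) addnn /=.
by apply: eq_bigl => x; lia.
Qed.

(* Exponents of [r = q^(1/4)]: [q^(x^2)] and [q^((x+1/2)^2)]. *)
Definition e_int (x : int) : nat := (4 * `|x| ^ 2)%N.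
Definition e_half (x : int) : nat := (absz (2 * x + 1)%R ^ 2)%N.

Lemma e_int_proper : proper_exp e_int.
Proof. by move=> x; rewrite /e_int; nia. Qed.
Lemma e_half_proper : proper_exp e_half.
Proof. by move=> x; rewrite /e_half; nia. Qed.

Definition t2 := theta_fps (fun _ => 1) e_half.
Definition t3 := theta_fps (fun _ => 1) e_int.
Definition t4 := theta_fps (fun x => (-1) ^+ `|x|%N) e_int.

Lemma e_intZ x : (e_int x)%:Z = 4 * x ^+ 2.
Proof. rewrite /e_int; nia. Qed.
Lemma e_halfZ x : (e_half x)%:Z = (2 * x + 1) ^+ 2.
Proof. rewrite /e_half; nia. Qed.

Definition box n : seq (int * int) := [seq (x, y) | x <- zrange n, y <- zrange n].

Lemma box_uniq n : uniq (box n).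
Proof. by apply: allpairs_uniq; rewrite ?zrange_uniq // => -[? ?] [? ?] _ _ /= [-> ->]. Qed.

Lemma mem_box e e' n p : proper_exp e -> proper_exp e' ->
  (e p.1 + e' p.2)%N = n -> p \in box n.
Proof.
case: p => x y pe pe' /= exy; apply/allpairsP; exists (x, y).
by rewrite !mem_zrange /=; have := pe x; have := pe' y; split=> //; lia.
Qed.

(** [C] describes the image of the substitution [h]. Landen's substitutions have index 2, so they
    reach only one parity class of pairs. *)
Lemma box_sum_bij e1 e1' e2 e2' (C : pred (int * int)) (F1 F2 : int * int -> K)
    (h : int * int -> int * int) n :
  proper_exp e1 -> proper_exp e1' -> proper_exp e2 -> proper_exp e2' ->
  injective h -> (forall p, e2 (h p).1 + e2' (h p).2 = e1 p.1 + e1' p.2)%N ->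
  (forall p, C (h p)) -> (forall q, C q -> exists p, h p = q) ->
  (forall p, F1 p = F2 (h p)) ->
  \sum_(p <- box n | (e1 p.1 + e1' p.2 == n)%N) F1 p =
  \sum_(q <- box n | (e2 q.1 + e2' q.2 == n)%N && C q) F2 q.
Proof.
move=> p1 p1' p2 p2' hI he hC hS hF.
apply: (eq_big_bij (h := h)); rewrite ?box_uniq //.
  move=> p _ /eqP ep; split=> //; last by rewrite he ep eqxx hC.
  by apply: (mem_box p2 p2'); rewrite he.
move=> q _ /andP[/eqP eq /hS [p hp]]; exists p; rewrite -he hp eq eqxx; split=> //.
by apply: (mem_box p1 p1'); rewrite -he hp.
Qed.

Lemma double_proper e : proper_exp e -> proper_exp (fun x => 2 * e x)%N.
Proof. by move=> pe x; have := pe x; lia. Qed.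

(* The substitutions [(x, y) = (m + m', m - m')] and their half-integral
   analogues, which double the form [x^2 + y^2]. *)
Lemma landen_even (F : int * int -> K) n :
  \sum_(p <- box n | (2 * e_int p.1 + 2 * e_int p.2 == n)%N) F (p.1 + p.2, p.1 - p.2) =
  \sum_(q <- box n | (e_int q.1 + e_int q.2 == n)%N && ~~ odd (`|q.1| + `|q.2|)) F q.
Proof.
pose h (p : int * int) := (p.1 + p.2, p.1 - p.2).
have pi := e_int_proper; have p2 := double_proper pi.
apply: (@box_sum_bij _ _ _ _ _ (fun p => F (h p)) F h n p2 p2 pi pi) => //.
- by move=> [x y] [x' y'] [] *; congr pair; lia.
- move=> [x y] /=.
  have := e_intZ x; have := e_intZ y; have := e_intZ (x + y); have := e_intZ (x - y); nia.
- by move=> [x y] /=; lia.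
- move=> [x y] /= xy; exists (((x + y) %/ 2)%Z, ((x - y) %/ 2)%Z).
  rewrite /h /=; congr pair; lia.
Qed.

Lemma landen_odd (F : int * int -> K) n :
  \sum_(p <- box n | (2 * e_half p.1 + 2 * e_half p.2 == n)%N) F (p.1 + p.2 + 1, p.1 - p.2) =
  \sum_(q <- box n | (e_int q.1 + e_int q.2 == n)%N && odd (`|q.1| + `|q.2|)) F q.
Proof.
pose h (p : int * int) := (p.1 + p.2 + 1, p.1 - p.2).
have pi := e_int_proper; have p2 := double_proper e_half_proper.
apply: (@box_sum_bij _ _ _ _ _ (fun p => F (h p)) F h n p2 p2 pi pi) => //.
- by move=> [x y] [x' y'] [] *; congr pair; lia.
- move=> [x y] /=.
  have := e_halfZ x; have := e_halfZ y; have := e_intZ (x + y + 1); have := e_intZ (x - y); nia.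
- by move=> [x y] /=; lia.
- move=> [x y] /= xy; exists (((x + y - 1) %/ 2)%Z, ((x - y - 1) %/ 2)%Z).
  rewrite /h /=; congr pair; lia.
Qed.

Lemma landen_half_odd (F : int * int -> K) n :
  \sum_(p <- box n | (2 * e_int p.1 + 2 * e_half p.2 == n)%N) F (p.1 + p.2, p.1 - p.2 - 1) =
  \sum_(q <- box n | (e_half q.1 + e_half q.2 == n)%N && odd (`|q.1| + `|q.2|)) F q.
Proof.
pose h (p : int * int) := (p.1 + p.2, p.1 - p.2 - 1).
have ph := e_half_proper; have p2 := double_proper ph.
have p2i := double_proper e_int_proper.
apply: (@box_sum_bij _ _ _ _ _ (fun p => F (h p)) F h n p2i p2 ph ph) => //.
- by move=> [x y] [x' y'] [] *; congr pair; lia.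
- move=> [x y] /=.
  have := e_intZ x; have := e_halfZ y; have := e_halfZ (x + y); have := e_halfZ (x - y - 1); nia.
- by move=> [x y] /=; lia.
- move=> [x y] /= xy; exists (((x + y + 1) %/ 2)%Z, ((x - y - 1) %/ 2)%Z).
  rewrite /h /=; congr pair; lia.
Qed.

Lemma landen_half_even (F : int * int -> K) n :
  \sum_(p <- box n | (2 * e_int p.1 + 2 * e_half p.2 == n)%N) F (p.2 + p.1, p.2 - p.1) =
  \sum_(q <- box n | (e_half q.1 + e_half q.2 == n)%N && ~~ odd (`|q.1| + `|q.2|)) F q.
Proof.
pose h (p : int * int) := (p.2 + p.1, p.2 - p.1).
have ph := e_half_proper; have p2 := double_proper ph.
have p2i := double_proper e_int_proper.
apply: (@box_sum_bij _ _ _ _ _ (fun p => F (h p)) F h n p2i p2 ph ph) => //.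
- by move=> [x y] [x' y'] [] *; congr pair; lia.
- move=> [x y] /=.
  have := e_intZ x; have := e_halfZ y; have := e_halfZ (y + x); have := e_halfZ (y - x); nia.
- by move=> [x y] /=; lia.
- move=> [x y] /= xy; exists (((x - y) %/ 2)%Z, ((x + y) %/ 2)%Z).
  rewrite /h /=; congr pair; lia.
Qed.

Local Notation a := (fps_sq t3).
Local Notation b := (fps_sq t2).

Lemma t3_sq : t3 ^+ 2 = a ^+ 2 + b ^+ 2.
Proof.
have pi := e_int_proper; have ph := e_half_proper.
rewrite (fps_sq_theta _ pi) (fps_sq_theta _ ph) !expr2; apply: fpsP => n.
rewrite coefsD !theta_fps_mul //; try exact: double_proper.
rewrite [LHS](bigID (fun p => odd (`|p.1| + `|p.2|)%N)) /= addrC; congr (_ + _).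
  by rewrite -(landen_even (fun _ => 1 * 1)).
by rewrite -(landen_odd (fun _ => 1 * 1)).
Qed.

(** The sign [(-1)^(x + y)] is constant on each parity class, which turns the sum in [t3_sq] into a
    difference. *)
Lemma t4_sq : t4 ^+ 2 = a ^+ 2 - b ^+ 2.
Proof.
have pi := e_int_proper; have ph := e_half_proper.
rewrite (fps_sq_theta _ pi) (fps_sq_theta _ ph) !expr2; apply: fpsP => n.
rewrite coefsB !theta_fps_mul //; try exact: double_proper.
rewrite [LHS](bigID (fun p => odd (`|p.1| + `|p.2|)%N)) /= addrC; congr (_ + _).
  rewrite -(landen_even (fun p => (-1) ^+ `|p.1|%N * (-1) ^+ `|p.2|%N)).
  apply: eq_bigr => p _; rewrite -exprD -signr_odd mulr1.
  by case: p => x y /=; have -> : odd (absz (x + y)%R + absz (x - y)%R) = false by lia.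
rewrite -(landen_odd (fun p => (-1) ^+ `|p.1|%N * (-1) ^+ `|p.2|%N)) -sumrN.
apply: eq_bigr => p _; rewrite -exprD -signr_odd mulr1.
by case: p => x y /=; have -> : odd (absz (x + y + 1)%R + absz (x - y)%R) = true by lia.
Qed.

(** Here both parity classes give the same product [a * b], whence the factor 2. *)
Lemma t2_sq : t2 ^+ 2 = 2%:R * a * b.
Proof.
have pi := e_int_proper; have ph := e_half_proper.
rewrite (fps_sq_theta _ pi) (fps_sq_theta _ ph) expr2 -mulrA mulr_natl mulr2n.
apply: fpsP => n; rewrite coefsD !theta_fps_mul //; try exact: double_proper.
rewrite [LHS](bigID (fun p => odd (`|p.1| + `|p.2|)%N)) /=; congr (_ + _).
  by rewrite -(landen_half_odd (fun _ => 1 * 1)).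
by rewrite -(landen_half_even (fun _ => 1 * 1)).
Qed.

End ThetaSeries.

(** * Differential equations of the theta series *)

Section ThetaDifferentialEquations.
Local Open Scope ring_scope.
Import mathcomp.algebra_tactics.ring.
Import Num.Theory.

Variable K : numDomainType.
Local Notation t2 := (t2 K).
Local Notation t3 := (t3 K).
Local Notation t4 := (t4 K).
Local Notation a := (fps_sq t3).
Local Notation b := (fps_sq t2).
Local Notation D := (@fps_D K).

Lemma t3_0 : t3 0%N = 1.
Proof. by rewrite /= big_cons big_nil /= addr0. Qed.
Lemma t4_0 : t4 0%N = 1.
Proof. by rewrite /= big_cons big_nil /= addr0. Qed.
Lemma t2_0 : t2 0%N = 0.
Proof. by rewrite /= big_cons big_nil. Qed.
Lemma t2_1 : t2 1%N = 2%:R.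
Proof. by rewrite /= !big_cons big_nil /= addr0. Qed.

Lemma fps_ord0 (f : fps K) : fps_ord 0 f. Proof. by []. Qed.
Lemma t2_ord : fps_ord 1 t2. Proof. by case=> // _; exact: t2_0. Qed.

Lemma coefs0M (f g : fps K) : (f * g) 0%N = f 0%N * g 0%N.
Proof. exact: (fps_ordM (fps_ord0 f) (fps_ord0 g)).2. Qed.
Lemma coefs0X (f : fps K) k : (f ^+ k) 0%N = f 0%N ^+ k.
Proof. by elim: k => [|k IH]; rewrite ?coefs1 // !exprS coefs0M IH. Qed.

Lemma coefs0D (f : fps K) : D f 0%N = 0.
Proof. exact: mul0r. Qed.

Lemma t3_cancel (f g : fps K) : t3 * f = t3 * g -> f = g.
Proof. by apply: (@fps_mulfI _ 0) => //; rewrite t3_0 oner_neq0. Qed.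
Lemma t4_cancel (f g : fps K) : t4 * f = t4 * g -> f = g.
Proof. by apply: (@fps_mulfI _ 0) => //; rewrite t4_0 oner_neq0. Qed.
Lemma nat_cancel k (f g : fps K) : k.+1%:R * f = k.+1%:R * g -> f = g.
Proof.
apply: (@fps_mulfI _ 0) => //; first by rewrite coefs_nat eqxx mulr1 pnatr_eq0.
Qed.

(** By Landen's formulas this is [(A + B)^2 = 4 A B + (A - B)^2] for [A = a^2], [B = b^2]. *)
Lemma jacobi_quartic : t3 ^+ 4 = t2 ^+ 4 + t4 ^+ 4.
Proof.
have -> : t3 ^+ 4 = (t3 ^+ 2) ^+ 2 by ring.
have -> : t2 ^+ 4 = (t2 ^+ 2) ^+ 2 by ring.
have -> : t4 ^+ 4 = (t4 ^+ 2) ^+ 2 by ring.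
by rewrite t3_sq t2_sq t4_sq; ring.
Qed.

Lemma sq_quartic : fps_sq t4 ^+ 4 = a ^+ 4 - b ^+ 4.
Proof.
have := congr1 (@fps_sq K) jacobi_quartic; rewrite fps_sqD !fps_sqX => ->; ring.
Qed.

(* Both sides have the same square and constant term 1. *)
Lemma sq_t4_sq : fps_sq t4 ^+ 2 = t3 * t4.
Proof.
apply/eqP; rewrite -subr_eq0; apply/eqP.
apply: (@fps_mulf_eq0 _ 0 (fps_sq t4 ^+ 2 + t3 * t4)) => //.
  rewrite coefsD coefs0X coefs0M t3_0 t4_0 (fps_sq_even t4 0) t4_0.
  by rewrite expr1n mulr1 -[1 + 1]/(2%:R) pnatr_eq0.
have -> : (fps_sq t4 ^+ 2 + t3 * t4) * (fps_sq t4 ^+ 2 - t3 * t4) =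
  fps_sq t4 ^+ 4 - t3 ^+ 2 * t4 ^+ 2 by ring.
by rewrite sq_quartic t3_sq t4_sq; ring.
Qed.

Let G := D t2 * t3 - t2 * D t3 - t4 ^+ 4 * t2 * t3.

Lemma D_sqr (f : fps K) : D (f ^+ 2) = 2%:R * (f * D f).
Proof. by rewrite fps_DX expr1; ring. Qed.

Lemma wronskian_a_b : 2%:R * fps_sq G = a * D b - b * D a - 2%:R * (a ^+ 4 - b ^+ 4) * a * b.
Proof.
rewrite /G !(fps_sqX, fps_sqB, fps_sqM) !fps_D_sq -sq_quartic.
ring.
Qed.

(** After multiplication by [2 * t2 * t3], only [t2^2], [t3^2], their derivatives and [t4^2] occur,
    and Landen's formulas rewrite all of these in [a] and [b]. *)
Lemma G_doubling : t2 * t3 * G = 2%:R * t4 ^+ 2 * fps_sq G.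
Proof.
apply: (@nat_cancel 1).
have -> : 2%:R * (t2 * t3 * G) =
   2%:R * (t2 * D t2) * t3 ^+ 2 - t2 ^+ 2 * (2%:R * (t3 * D t3))
   - 2%:R * (t4 ^+ 2) ^+ 2 * t2 ^+ 2 * t3 ^+ 2 by rewrite /G; ring.
have -> : 2%:R * (2%:R * t4 ^+ 2 * fps_sq G) = 2%:R * t4 ^+ 2 * (2%:R * fps_sq G) by ring.
rewrite wronskian_a_b -!D_sqr t2_sq t3_sq t4_sq !(D_sqr, fps_DD, fps_DM, fps_D_nat).
ring.
Qed.

(* If [G] had order [v], comparing orders in [G_doubling] would give
   [v + 1 = 2 v], but the coefficient of [r] in [G] vanishes. *)
Lemma G_eq0 : G = 0.
Proof.
have G0 : G 0%N = 0.
  by rewrite /G !coefsB !coefs0M !coefs0D t2_0 !(mulr0, mul0r) !subr0.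
have tt : fps_ord 1 (t2 * t3) /\ (t2 * t3) 1%N = 2%:R.
  by have [] := fps_ordM t2_ord (fps_ord0 t3); rewrite addn0 t3_0 mulr1 t2_1.
have G1 : G 1%N = 0.
  have -> : G = D t2 * t3 - t2 * D t3 - t4 ^+ 4 * (t2 * t3) by rewrite /G; ring.
  rewrite !coefsB.
  have [_] := fps_ordM (fps_ord0 (t4 ^+ 4)) tt.1.
  rewrite add0n coefs0X t4_0 expr1n tt.2 mul1r => ->.
  have oD : fps_ord 1 (D t2) by case=> // _; exact: coefs0D.
  have [_] := fps_ordM oD (fps_ord0 t3).
  rewrite addn0 t3_0 mulr1 => ->.
  have [_] := fps_ordM t2_ord (fps_ord0 (D t3)); rewrite addn0 => ->.
  have -> : D t2 1%N = t2 1%N by exact: mul1r.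
  by rewrite coefs0D t2_1 mulr0 subr0 subrr.
apply: fpsP => n; rewrite coefs0; elim/ltn_ind: n => -[|[|n]] // IH.
have [_] := fps_ordM tt.1 IH; rewrite G_doubling tt.2 => E.
(* With [v = n + 2], the left side is read at index [v + 1], which lies below [2 v] because
   [v >= 2]; hence the separate treatment of [G0] and [G1]. *)
have oS : fps_ord (n.+2).*2 (fps_sq G).
  move=> k ltk /=; case: ifP => // ev; apply: IH; lia.
have [E' _] := fps_ordM (fps_ord0 (2%:R * t4 ^+ 2)) oS.
move: E; rewrite E'; last by lia.
by move/esym/eqP; rewrite mulf_eq0 pnatr_eq0 => /eqP.
Qed.

(** No second descent: in terms of [a] and [b], the Wronskian of [t3^2] and [t4^2] is a multiple of
    that of [a] and [b], known from [G = 0] at [r^2]. *)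
Lemma D_t3_t4 : D t3 * t4 - t3 * D t4 = t2 ^+ 4 * t3 * t4.
Proof.
apply: t3_cancel; apply: t4_cancel; apply: (@nat_cancel 1).
have -> : 2%:R * (t4 * (t3 * (D t3 * t4 - t3 * D t4))) =
   2%:R * (t3 * D t3) * t4 ^+ 2 - t3 ^+ 2 * (2%:R * (t4 * D t4)) by ring.
have -> : 2%:R * (t4 * (t3 * (t2 ^+ 4 * t3 * t4))) =
   2%:R * ((t2 ^+ 2) ^+ 2 * t3 ^+ 2 * t4 ^+ 2) by ring.
have := wronskian_a_b; rewrite G_eq0.
have -> : fps_sq (0 : fps K) = 0 by rewrite (fps_sq_nat K 0).
rewrite mulr0 => W.
rewrite -!D_sqr t2_sq t3_sq t4_sq !(D_sqr, fps_DB, fps_DD, fps_DM, fps_D_nat).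
apply/eqP; rewrite -subr_eq0; apply/eqP.
(* The difference of the two sides is [4 a b] times the relation [W]. *)
transitivity (4%:R * a * b * 0 : fps K); last by rewrite mulr0.
rewrite W; ring.
Qed.

(** [u] is the logarithmic derivative of [t3]. The equations are multiplicative because [t2] has
    constant term 0 and is not invertible. *)
Lemma D_log_t3 : exists u, [/\ D t3 = u * t3, D t2 = (u + t4 ^+ 4) * t2
  & D t4 = (u - t2 ^+ 4) * t4].
Proof.
have [g t3g] := fps_inv_exists t3_0; exists (D t3 * g).
have E3 : D t3 = D t3 * g * t3 by rewrite -mulrA [g * _]mulrC t3g mulr1.
split=> //; apply: t3_cancel.
  transitivity (G + t2 * D t3 + t4 ^+ 4 * t2 * t3); first by rewrite /G; ring.
  by rewrite G_eq0 {1}E3; ring.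
transitivity (D t3 * t4 - t2 ^+ 4 * t3 * t4); first by rewrite -D_t3_t4; ring.
by rewrite {1}E3; ring.
Qed.

(* The defect [X] of the differential equation for [u] satisfies
   [X = 4 X(r^2)], which forces [X = 0]. *)
Lemma D_log_t3_riccati u : D t3 = u * t3 -> D t2 = (u + t4 ^+ 4) * t2 ->
    D t4 = (u - t2 ^+ 4) * t4 ->
  D u = 2%:R * u ^+ 2 + 2%:R * t2 ^+ 4 * t4 ^+ 4.
Proof.
move=> E3 E2 E4.
pose X := D u - 2%:R * u ^+ 2 - 2%:R * t2 ^+ 4 * t4 ^+ 4.
suff X0 : X = 0 by apply/eqP; rewrite -subr_eq0 -X0 /X; apply/eqP; ring.
pose U := fps_sq u.
have Ea : D a = 2%:R * U * a by rewrite fps_D_sq E3 fps_sqM -/U; ring.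
have Eb : D b = 2%:R * (U + a ^+ 4 - b ^+ 4) * b.
  by rewrite fps_D_sq E2 fps_sqM fps_sqD fps_sqX sq_quartic -/U; ring.
have t2_4 : t2 ^+ 4 = 4%:R * a ^+ 2 * b ^+ 2.
  by rewrite -[4%N]/(2 * 2)%N exprM t2_sq; ring.
have t4_4 : t4 ^+ 4 = (a ^+ 2 - b ^+ 2) ^+ 2.
  by rewrite -[4%N]/(2 * 2)%N exprM t4_sq; ring.
(* The logarithmic derivative of [fps_sq t4 ^+ 2 = t3 * t4] expresses [u(r^2)] through [u]. *)
have EU : 2%:R * U = 2%:R * b ^+ 4 + u - 2%:R * a ^+ 2 * b ^+ 2.
  apply: (@nat_cancel 1); apply: t3_cancel; apply: t4_cancel.
  have := congr1 D sq_t4_sq.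
  rewrite D_sqr fps_D_sq E4 fps_sqM fps_sqB fps_sqX -/U fps_DM E3 E4.
  have -> : 2%:R * (fps_sq t4 * (2%:R * ((U - b ^+ 4) * fps_sq t4))) =
    4%:R * (U - b ^+ 4) * fps_sq t4 ^+ 2 by ring.
  rewrite sq_t4_sq => E.
  have -> : t4 * (t3 * (2%:R * (2%:R * U))) =
     4%:R * (U - b ^+ 4) * (t3 * t4) + 4%:R * b ^+ 4 * t3 * t4 by ring.
  rewrite E; have -> : u * t3 * t4 + t3 * ((u - t2 ^+ 4) * t4) =
     t3 * t4 * (2%:R * u - t2 ^+ 4) by ring.
  by rewrite t2_4; ring.
have X4 : 4%:R * fps_sq X = X.
  apply: (@nat_cancel 1).
  rewrite /X !(fps_sqX, fps_sqB, fps_sqM, fps_sq_nat) -/U sq_quartic.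
  (* Grouping [U] as [2 * U] lets [EU] be substituted without dividing by 2. *)
  have -> : 2%:R * (4%:R * (fps_sq (D u) - 2%:R * U ^+ 2 - 2%:R * b ^+ 4 * (a ^+ 4 - b ^+ 4))) = 2%:R * D (2%:R * U) - 4%:R * (2%:R * U) ^+ 2 - 16%:R * b ^+ 4 * (a ^+ 4 - b ^+ 4).
    by rewrite fps_DM fps_D_nat fps_D_sq -/U; ring.
  rewrite EU !(fps_DX, fps_DB, fps_DD, fps_DM, fps_D_nat) Ea Eb t2_4 t4_4.
  have -> : 2%:R * (U + a ^+ 4 - b ^+ 4) * b = (2%:R * U + 2%:R * a ^+ 4 - 2%:R * b ^+ 4) * b by ring.
  rewrite EU.
  ring.
(* At index 0 the equation reads [3 X_0 = 0]; an odd coefficient vanishes; a positive even one is 4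
   times the coefficient at half its index. *)
apply: fpsP => n; rewrite coefs0; elim/ltn_ind: n => -[|n] IH.
  have := congr1 (fun f : fps K => f 0%N) X4; rewrite coefs_natM (fps_sq_even X 0).
  move/eqP; rewrite -subr_eq0 -[X in _ - X]mul1r -mulrBl mulf_eq0.
  by rewrite -(natrB K (isT : (1 <= 4)%N)) pnatr_eq0 => /eqP.
rewrite -X4 coefs_natM.
have -> : fps_sq X n.+1 = if odd n.+1 then 0 else X n.+1./2 by [].
case: ifP => ev; first by rewrite mulr0.
by rewrite IH ?mulr0 //; lia.
Qed.

(** With [D t3 = u t3] the left side is [t3^2 (D u - 2 u^2)], so the constant 3 is the one that
    removes [u^2] through the Riccati equation. *)
Theorem t3_degree4 :
  t3 * D (D t3) - 3%:R * D t3 ^+ 2 = 2%:R * (t2 ^+ 4 * t4 ^+ 4) * t3 ^+ 2.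
Proof.
have [u [E3 E2 E4]] := D_log_t3; have Eu := D_log_t3_riccati E3 E2 E4.
by rewrite E3 fps_DM E3 Eu; ring.
Qed.

(** The left side is [t3^3 (D (D u) - 12 u D u + 16 u^3)]; substituting the Riccati equation twice
    cancels every term that contains [u]. *)
Theorem t3_degree6 :
  t3 ^+ 2 * D (D (D t3)) - 15%:R * t3 * D t3 * D (D t3) + 30%:R * D t3 ^+ 3 =
  8%:R * (t4 ^+ 4 - t2 ^+ 4) * (t2 ^+ 4 * t4 ^+ 4) * t3 ^+ 3.
Proof.
have [u [E3 E2 E4]] := D_log_t3; have Eu := D_log_t3_riccati E3 E2 E4.
rewrite E3 !(fps_DD, fps_DM) E3 Eu !(fps_DX, fps_DD, fps_DM, fps_D_nat) E2 E3 E4 Eu.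
ring.
Qed.

End ThetaDifferentialEquations.

(** * Limits and finite sums of complex numbers *)

Section ComplexLimits.
Local Open Scope R_scope.

(** Limits are taken by components so that sums and products reduce to real sequences;
    [Clim_filterlim] returns to the filter form of the statement. *)
Definition Clim (u : nat -> C) (l : C) :=
  is_lim_seq (fun n => Re (u n)) (Re l) /\ is_lim_seq (fun n => Im (u n)) (Im l).

Lemma Clim_ext u v l : (forall n, u n = v n) -> Clim u l -> Clim v l.
Proof.
by move=> uv [ur ui]; split; [apply: is_lim_seq_ext ur | apply: is_lim_seq_ext ui];
   move=> n; rewrite uv.
Qed.

Lemma Clim_const c : Clim (fun=> c) c.
Proof. by split; apply: is_lim_seq_const. Qed.

Lemma Clim_plus u v a b : Clim u a -> Clim v b ->
  Clim (fun n => Cplus (u n) (v n)) (Cplus a b).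
Proof. by move=> [ur ui] [vr vi]; split; apply: is_lim_seq_plus'. Qed.

Lemma Clim_mult u v a b : Clim u a -> Clim v b ->
  Clim (fun n => Cmult (u n) (v n)) (Cmult a b).
Proof.
move=> [ur ui] [vr vi]; split.
  by apply: is_lim_seq_minus'; apply: is_lim_seq_mult'.
by apply: is_lim_seq_plus'; apply: is_lim_seq_mult'.
Qed.

Lemma Clim_filterlim u l : Clim u l -> filterlim u eventually (locally l).
Proof.
move=> [/is_lim_seq_spec ur /is_lim_seq_spec ui]; apply/filterlim_locally => eps.
have [N1 h1] := ur eps; have [N2 h2] := ui eps; exists (maxn N1 N2) => n /leP len.
by split; [apply: h1 | apply: h2]; apply/leP; lia.
Qed.

Lemma Zsum_lim f l : Clim (Zpartial f) l -> Zsum f = l.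
Proof.
move=> /Clim_filterlim fl.
exact (@iota_filterlim_locally _ C_CompleteNormedModule _ eventually
  (Proper_StrongProper _ eventually_filter) _ _ fl).
Qed.

Lemma CplusA : associative Cplus. Proof. exact: Cplus_assoc. Qed.
Lemma CplusC : commutative Cplus. Proof. exact: Cplus_comm. Qed.
Lemma Cplus0 : left_id (RtoC 0) Cplus. Proof. exact: Cplus_0_l. Qed.
Lemma CmultA : associative Cmult. Proof. exact: Cmult_assoc. Qed.
Lemma CmultC : commutative Cmult. Proof. exact: Cmult_comm. Qed.
Lemma Cmult1 : left_id (RtoC 1) Cmult. Proof. exact: Cmult_1_l. Qed.
Lemma Cmult0 : left_zero (RtoC 0) Cmult. Proof. by move=> x; ring. Qed.
Lemma Cmult0r : right_zero (RtoC 0) Cmult. Proof. by move=> x; ring. Qed.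
Lemma CmultDl : left_distributive Cmult Cplus. Proof. by move=> x y z; ring. Qed.
Lemma CmultDr : right_distributive Cmult Cplus. Proof. by move=> x y z; ring. Qed.

(** These structures give access to distributivity for iterated sums and products, which separates
    the variables in [Znpartial_theta]. *)
HB.instance Definition _ := Monoid.isComLaw.Build C (RtoC 0) Cplus CplusA CplusC Cplus0.
HB.instance Definition _ := Monoid.isComLaw.Build C (RtoC 1) Cmult CmultA CmultC Cmult1.
HB.instance Definition _ := Monoid.isMulLaw.Build C (RtoC 0) Cmult Cmult0 Cmult0r.
HB.instance Definition _ := Monoid.isAddLaw.Build C Cmult Cplus CmultDl CmultDr.

Lemma Clim_sum (I : Type) (s : seq I) (u : I -> nat -> C) (l : I -> C) :
  (forall i, Clim (u i) (l i)) ->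
  Clim (fun n => \big[Cplus/RtoC 0]_(i <- s) u i n) (\big[Cplus/RtoC 0]_(i <- s) l i).
Proof.
move=> ul; elim: s => [|i s IH].
  by rewrite big_nil; apply: Clim_ext (Clim_const _) => n; rewrite big_nil.
rewrite big_cons; apply: Clim_ext (Clim_plus (ul i) IH) => n; by rewrite big_cons.
Qed.

Lemma Clim_prod (I : Type) (s : seq I) (u : I -> nat -> C) (l : I -> C) :
  (forall i, Clim (u i) (l i)) ->
  Clim (fun n => \big[Cmult/RtoC 1]_(i <- s) u i n) (\big[Cmult/RtoC 1]_(i <- s) l i).
Proof.
move=> ul; elim: s => [|i s IH].
  by rewrite big_nil; apply: Clim_ext (Clim_const _) => n; rewrite big_nil.
rewrite big_cons; apply: Clim_ext (Clim_mult (ul i) IH) => n; by rewrite big_cons.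
Qed.

Lemma Re_big (I : Type) (s : seq I) (P : pred I) (f : I -> C) :
  Re (\big[Cplus/RtoC 0]_(i <- s | P i) f i) = (\sum_(i <- s | P i) Re (f i))%R.
Proof. by apply: (big_morph Re). Qed.
Lemma Im_big (I : Type) (s : seq I) (P : pred I) (f : I -> C) :
  Im (\big[Cplus/RtoC 0]_(i <- s | P i) f i) = (\sum_(i <- s | P i) Im (f i))%R.
Proof. by apply: (big_morph Im). Qed.

Lemma CpownS w n : Cpown w n.+1 = Cmult w (Cpown w n). Proof. by []. Qed.
Lemma CpownD w m n : Cpown w (m + n) = Cmult (Cpown w m) (Cpown w n).
Proof. exact: (@pow_n_plus C_Ring). Qed.
Lemma CpownM w m n : Cpown w (m * n) = Cpown (Cpown w m) n.
Proof.
by elim: n => [|n IH]; rewrite ?muln0 // mulnS CpownD CpownS IH.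
Qed.
Lemma Cpown_mul v w n : Cpown (Cmult v w) n = Cmult (Cpown v n) (Cpown w n).
Proof. by elim: n => [|n IH]; rewrite ?CpownS ?IH; [rewrite Cmult1 | ring]. Qed.
Lemma Cmod_Cpown w n : Cmod (Cpown w n) = Cmod w ^ n.
Proof. by elim: n => [|n IH]; rewrite ?Cmod_1 // CpownS Cmod_mult IH. Qed.
Lemma big_Cmult_const (I : finType) w :
  \big[Cmult/RtoC 1]_(i : I) w = Cpown w #|I|.
Proof. by rewrite big_const; elim: #|I| => [|n IH] //=; rewrite IH. Qed.

End ComplexLimits.

(** * Evaluation of power series in the unit disc *)

Section Evaluation.
Local Open Scope R_scope.

(** A class that contains the theta and moment series, is closed under the ring operations, and
    guarantees absolute convergence in the open unit disc. *)
Definition poly_bounded (f : fps R) :=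
  exists A k, 0 <= A /\ forall n, Rabs (f n) <= A * (INR n + 1) ^ k.

Lemma INR1_ge1 n : 1 <= INR n + 1.
Proof. by have := pos_INR n; lra. Qed.

Lemma poly_boundedD f g : poly_bounded f -> poly_bounded g -> poly_bounded (f + g)%R.
Proof.
move=> [A [k [A0 fA]]] [B [l [B0 gB]]]; exists (A + B), (k + l)%N; split; first lra.
move=> n; have le1 := INR1_ge1 n.
apply: Rle_trans (Rabs_triang _ _) _.
have pk : 1 <= (INR n + 1) ^ k by apply: pow_R1_Rle.
have pl : 1 <= (INR n + 1) ^ l by apply: pow_R1_Rle.
have := fA n; have := gB n; rewrite pow_add.
set p := _ ^ k in pk *; set q := _ ^ l in pl * => hg hf.
have h1 : A * p <= A * (p * q) by apply: Rmult_le_compat_l => //; nra.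
have h2 : B * q <= B * (p * q) by apply: Rmult_le_compat_l => //; nra.
lra.
Qed.

Lemma poly_boundedN f : poly_bounded f -> poly_bounded (- f)%R.
Proof.
by move=> [A [k [A0 fA]]]; exists A, k; split=> // n; rewrite /= Rabs_Ropp.
Qed.

Lemma poly_boundedB f g : poly_bounded f -> poly_bounded g -> poly_bounded (f - g)%R.
Proof. by move=> pf pg; apply: poly_boundedD => //; apply: poly_boundedN. Qed.

Lemma INR_natr n : (n%:R)%R = INR n :> R.
Proof. by rewrite INRE. Qed.

(** The convolution has [n + 1] terms of size at most [A B (n + 1)^(k + l)], which raises the
    exponent by one more. *)
Lemma poly_boundedM f g : poly_bounded f -> poly_bounded g -> poly_bounded (f * g)%R.
Proof.
move=> [A [k [A0 fA]]] [B [l [B0 gB]]]; exists (A * B), (k + l).+1; split; first nra.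
move=> n; have le1 := INR1_ge1 n.
have mono m j : (m <= n)%N -> (INR m + 1) ^ j <= (INR n + 1) ^ j.
  move=> lemn; apply: pow_incr; have := pos_INR m.
  have : INR m <= INR n by apply: le_INR; apply/leP; exact: lemn.
  lra.
pose X := A * B * (INR n + 1) ^ (k + l).
suff bound m : (m <= n.+1)%N ->
    Rabs (\sum_(i < m) f i * g (n - i)%N)%R <= INR m * X.
  by have := bound n.+1 (leqnn _); rewrite S_INR /X /=; nra.
elim: m => [|m IH] lem; first by rewrite big_ord0 Rabs_R0 /=; lra.
rewrite big_ord_recr S_INR /= -[(_ + _)%R]/(_ + _).
apply: Rle_trans (Rabs_triang _ _) _.
rewrite -[(f m * _)%R]/(f m * _) Rabs_mult.
have lemn : (m <= n)%N by [].
have h0 := IH (ltnW lem); have h1 := fA m; have h2 := gB (n - m)%N.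
have m1 := mono _ k lemn; have m2 := mono _ l (leq_subr m n).
have Y : Rabs (f m) * Rabs (g (n - m)%N) <= X.
  rewrite /X pow_add.
  have -> : A * B * ((INR n + 1) ^ k * (INR n + 1) ^ l) =
    (A * (INR n + 1) ^ k) * (B * (INR n + 1) ^ l) by ring.
  apply: Rmult_le_compat; try exact: Rabs_pos.
    apply: Rle_trans h1 _; exact: Rmult_le_compat_l.
  apply: Rle_trans h2 _; exact: Rmult_le_compat_l.
by rewrite Rmult_plus_distr_r Rmult_1_l; apply: Rplus_le_compat.
Qed.

Lemma poly_bounded_finite (f : fps R) A : (forall n, Rabs (f n) <= A) -> poly_bounded f.
Proof.
move=> fA; exists A, 0%N; split; last by move=> n /=; rewrite Rmult_1_r.
exact: Rle_trans (Rabs_pos (f 0%N)) (fA 0%N).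
Qed.

Lemma poly_bounded_nat k : poly_bounded (k%:R)%R.
Proof.
apply: (@poly_bounded_finite _ (INR k)) => n; rewrite coefs_nat INR_natr.
case: (n == 0%N) => /=; rewrite ?mulr1 ?mulr0 ?Rabs_R0; last exact: pos_INR.
by rewrite Rabs_pos_eq; [right | exact: pos_INR].
Qed.

Lemma poly_boundedX f k : poly_bounded f -> poly_bounded (f ^+ k)%R.
Proof.
move=> pf; elim: k => [|k IH]; first exact: (poly_bounded_nat 1).
by rewrite exprS; apply: poly_boundedM.
Qed.

Lemma poly_bounded_summable f rho : poly_bounded f -> 0 <= rho < 1 ->
  ex_series (fun n => Rabs (f n) * rho ^ n).
Proof.
(* [r'] lies strictly between [rho] and 1 and stays positive when [rho = 0]; the ratio test needs
   nonzero terms. *)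
move=> [A [k [A0 fA]]] [r0 r1]; pose r' := (1 + rho) / 2.
have r'0 : 0 < r' by rewrite /r'; lra.
pose a n := (INR n + 1) ^ k * r' ^ n.
have apos n : 0 < a n.
  apply: Rmult_lt_0_compat; apply: pow_lt => //; by have := INR1_ge1 n; lra.
have sa : ex_series (fun n => Rabs (a n)).
  apply: (@ex_series_DAlembert a r'); first by rewrite /r'; lra.
    by move=> n; have := apos n; lra.
  have lim1 : is_lim_seq (fun n => 1 + / (INR n + 1)) 1.
    have -> : Rbar.Finite 1 = Rbar.Finite (Rplus 1 0) by rewrite Rplus_0_r.
    apply: is_lim_seq_plus'; first exact: is_lim_seq_const.
    apply: (@is_lim_seq_ext (fun n => / INR n.+1)).
      by move=> n; rewrite S_INR.
    apply: (proj1 (is_lim_seq_incr_1 (fun n => / INR n) 0)).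
    exact: (is_lim_seq_inv INR p_infty is_lim_seq_INR).
  have limk j : is_lim_seq (fun n => (1 + / (INR n + 1)) ^ j) 1.
    elim: j => [|j IH]; first exact: is_lim_seq_const.
    have -> : Rbar.Finite 1 = Rbar.Finite (Rmult 1 1) by rewrite Rmult_1_r.
    by apply: is_lim_seq_mult'.
  apply: (@is_lim_seq_ext (fun n => (1 + / (INR n + 1)) ^ k * r')).
    move=> n; have p1 := INR1_ge1 n.
    rewrite Rabs_pos_eq; last by apply: Rlt_le; apply: Rdiv_lt_0_compat.
    rewrite /a S_INR.
    have -> : 1 + / (INR n + 1) = (INR n + 1 + 1) / (INR n + 1) by field; lra.
    rewrite /Rdiv Rpow_mult_distr pow_inv /=; field.
    by split; apply: pow_nonzero; lra.
  have -> : Rbar.Finite r' = Rbar.Finite (Rmult 1 r') by rewrite Rmult_1_l.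
  by apply: is_lim_seq_mult'; [exact: limk | exact: is_lim_seq_const].
apply: (@ex_series_le _ R_CompleteNormedModule _ (fun n => A * Rabs (a n))).
  move=> n; rewrite /norm /= /abs /= Rabs_pos_eq; last first.
    by apply: Rmult_le_pos; [exact: Rabs_pos | exact: pow_le].
  rewrite (Rabs_pos_eq (a n)); last exact: Rlt_le.
  rewrite /a -Rmult_assoc; apply: Rmult_le_compat => //.
  - exact: Rabs_pos.
  - exact: pow_le.
  - by apply: pow_incr; rewrite /r'; lra.
by apply: ex_series_scal_l.
Qed.

(** [Series] is total, so the value is meaningful only under convergence; hence the [poly_bounded]
    hypotheses of the evaluation rules. *)
Definition fps_ev (r : C) (f : fps R) : C :=
  (Series (fun n => f n * Re (Cpown r n)), Series (fun n => f n * Im (Cpown r n))).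

Section AtPoint.
Variables (r : C) (r_lt1 : Cmod r < 1).

Lemma fps_ev_abs f (g : nat -> R) : poly_bounded f -> (forall n, Rabs (g n) <= Cmod r ^ n) ->
  ex_series (fun n => Rabs (f n * g n)).
Proof.
move=> pf gr.
have sm := poly_bounded_summable pf (conj (Cmod_ge_0 r) r_lt1).
apply: (@ex_series_le _ R_CompleteNormedModule _ _ _ sm) => n.
rewrite /norm /= /abs /= Rabs_Rabsolu Rabs_mult.
by apply: Rmult_le_compat_l; [exact: Rabs_pos | exact: gr].
Qed.

Lemma Re_Cpown_le n : Rabs (Re (Cpown r n)) <= Cmod r ^ n.
Proof. by rewrite -Cmod_Cpown; exact: re_le_Cmod. Qed.
Lemma Im_Cpown_le n : Rabs (Im (Cpown r n)) <= Cmod r ^ n.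
Proof.
rewrite -Cmod_Cpown /Cmod -sqrt_Rsqr_abs; apply: sqrt_le_1_alt.
by rewrite /Rsqr /Im; nra.
Qed.

Lemma fps_ev_Re f : poly_bounded f ->
  is_series (fun n => f n * Re (Cpown r n)) (Re (fps_ev r f)).
Proof.
by move=> pf; apply: Series_correct; apply: ex_series_Rabs; apply: fps_ev_abs Re_Cpown_le.
Qed.
Lemma fps_ev_Im f : poly_bounded f ->
  is_series (fun n => f n * Im (Cpown r n)) (Im (fps_ev r f)).
Proof.
by move=> pf; apply: Series_correct; apply: ex_series_Rabs; apply: fps_ev_abs Im_Cpown_le.
Qed.

Lemma fps_ev_unique (f : fps R) l : is_series (fun n => f n * Re (Cpown r n)) (Re l) ->
  is_series (fun n => f n * Im (Cpown r n)) (Im l) -> fps_ev r f = l.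
Proof. by case: l => x y /= /is_series_unique hx /is_series_unique hy; congr pair. Qed.

Lemma fps_evD f g : poly_bounded f -> poly_bounded g ->
  fps_ev r (f + g)%R = Cplus (fps_ev r f) (fps_ev r g).
Proof.
move=> pf pg; apply: fps_ev_unique.
  apply: is_series_ext (is_series_plus _ _ _ _ (fps_ev_Re pf) (fps_ev_Re pg)) => n.
  by rewrite /plus /= -[(_ + _)%R]/(_ + _); ring.
apply: is_series_ext (is_series_plus _ _ _ _ (fps_ev_Im pf) (fps_ev_Im pg)) => n.
by rewrite /plus /= -[(_ + _)%R]/(_ + _); ring.
Qed.

Lemma fps_evN f : poly_bounded f -> fps_ev r (- f)%R = Copp (fps_ev r f).
Proof.
move=> pf; apply: fps_ev_unique.
  apply: is_series_ext (is_series_opp _ _ (fps_ev_Re pf)) => n.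
  exact: Ropp_mult_distr_l.
apply: is_series_ext (is_series_opp _ _ (fps_ev_Im pf)) => n.
exact: Ropp_mult_distr_l.
Qed.

Lemma fps_evB f g : poly_bounded f -> poly_bounded g ->
  fps_ev r (f - g)%R = Cminus (fps_ev r f) (fps_ev r g).
Proof. by move=> pf pg; rewrite fps_evD ?fps_evN //; apply: poly_boundedN. Qed.

Lemma sum_f_R0_big (u : nat -> R) n : sum_f_R0 u n = (\sum_(i < n.+1) u i)%R.
Proof.
elim: n => [|n IH]; first by rewrite big_ord1.
by rewrite big_ord_recr /= IH.
Qed.

Lemma cauchy_term (f g : fps R) (x y : nat -> R) n :
  sum_f_R0 (fun k => (f k * x k) * (g (n - k)%N * y (n - k)%N)) n =
  (\sum_(i < n.+1) f i * g (n - i)%N * (x i * y (n - i)%N))%R.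
Proof.
rewrite sum_f_R0_big; apply: eq_bigr => i _.
by rewrite -[RHS]/(f i * g (n - i)%N * (x i * y (n - i)%N)); ring.
Qed.

Lemma cauchy_series (f g : fps R) (x y : nat -> R) la lb :
  is_series (fun n => f n * x n) la -> is_series (fun n => g n * y n) lb ->
  ex_series (fun n => Rabs (f n * x n)) -> ex_series (fun n => Rabs (g n * y n)) ->
  is_series (fun n => (\sum_(i < n.+1) f i * g (n - i)%N * (x i * y (n - i)%N))%R)
    (la * lb).
Proof.
move=> fx gy afx agy; apply: is_series_ext (is_series_mult _ _ _ _ fx gy afx agy).
exact: cauchy_term.
Qed.

(** Four real Cauchy products, of the real and imaginary parts, recombine through
    [r^i * r^(n - i) = r^n]. *)
Lemma fps_evM f g : poly_bounded f -> poly_bounded g ->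
  fps_ev r (f * g)%R = Cmult (fps_ev r f) (fps_ev r g).
Proof.
move=> pf pg.
have fR := fps_ev_Re pf; have fI := fps_ev_Im pf.
have gR := fps_ev_Re pg; have gI := fps_ev_Im pg.
have afR := fps_ev_abs pf Re_Cpown_le; have afI := fps_ev_abs pf Im_Cpown_le.
have agR := fps_ev_abs pg Re_Cpown_le; have agI := fps_ev_abs pg Im_Cpown_le.
have RR := cauchy_series fR gR afR agR.
have II := cauchy_series fI gI afI agI.
have RI := cauchy_series fR gI afR agI.
have IR := cauchy_series fI gR afI agR.
have split_pow n (i : 'I_n.+1) :
    Cpown r n = Cmult (Cpown r i) (Cpown r (n - i)).
  by rewrite -CpownD subnKC // -ltnS.
apply: fps_ev_unique.
  apply: is_series_ext (is_series_minus _ _ _ _ RR II) => n.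
  transitivity (\sum_(i < n.+1) f i * g (n - i)%N * (Re (Cpown r i) * Re (Cpown r (n - i))) -
    \sum_(i < n.+1) f i * g (n - i)%N * (Im (Cpown r i) * Im (Cpown r (n - i))))%R => //.
  rewrite -sumrB coefsM; transitivity
    ((\sum_(i < n.+1) f i * g (n - i)%N) * Re (Cpown r n))%R => //.
  rewrite mulr_suml.
  by apply: eq_bigr => i _; rewrite (split_pow n i) -mulrBr.
apply: is_series_ext (is_series_plus _ _ _ _ RI IR) => n.
transitivity (\sum_(i < n.+1) f i * g (n - i)%N * (Re (Cpown r i) * Im (Cpown r (n - i))) +
  \sum_(i < n.+1) f i * g (n - i)%N * (Im (Cpown r i) * Re (Cpown r (n - i))))%R => //.
rewrite -big_split coefsM; transitivity
  ((\sum_(i < n.+1) f i * g (n - i)%N) * Im (Cpown r n))%R => //.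
rewrite mulr_suml.
by apply: eq_bigr => i _; rewrite (split_pow n i) /= -mulrDr.
Qed.

Lemma fps_ev1 : fps_ev r 1%R = RtoC 1.
Proof.
have one (g : nat -> R) : is_series (fun n => (1%R : fps R) n * g n) (g 0%N).
  suff : is_lim_seq (sum_n (fun n => (1%R : fps R) n * g n)) (g 0%N) by [].
  apply: is_lim_seq_ext (is_lim_seq_const (g 0%N)).
  elim=> [|n IH]; first by rewrite sum_O coefs1 /= Rmult_1_l.
  by rewrite sum_Sn -IH coefs1 /= /plus /= Rmult_0_l Rplus_0_r.
by apply: fps_ev_unique; apply: (one (fun n => _ (Cpown r n))).
Qed.

Lemma fps_ev_nat k : fps_ev r (k%:R)%R = RtoC (INR k).
Proof.
elim: k => [|k IH].
  have p1 := poly_bounded_nat 1.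
  by rewrite mulr0n -(subrr (1%R : fps R)) fps_evB // fps_ev1 /=; ring.
rewrite -natr1 fps_evD ?IH ?fps_ev1; first by rewrite S_INR RtoC_plus.
  exact: poly_bounded_nat.
exact: (poly_bounded_nat 1).
Qed.

Lemma fps_evX f k : poly_bounded f -> fps_ev r (f ^+ k)%R = Cpown (fps_ev r f) k.
Proof.
move=> pf; elim: k => [|k IH]; first by rewrite fps_ev1.
by rewrite exprS fps_evM ?IH //; apply: poly_boundedX.
Qed.

End AtPoint.
End Evaluation.

(** * Symmetric sums over the integers as values of power series *)

Section ThetaValues.
Local Open Scope R_scope.

Definition Z_of_zint (x : int) : Z :=
  match x with Posz n => Z.of_nat n | Negz n => Z.opp (Z.of_nat n.+1) end.

Lemma Z_of_zintB k N : Z_of_zint (k%:Z - N%:Z)%R = Z.sub (Z.of_nat k) (Z.of_nat N).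
Proof.
have [leNk|ltkN] := leqP N k.
  have -> : (k%:Z - N%:Z = (k - N)%N%:Z)%R by lia.
  by rewrite /Z_of_zint; lia.
have -> : (k%:Z - N%:Z = Negz (N - k).-1)%R by lia.
by rewrite /Z_of_zint; lia.
Qed.

Lemma abs_nat_zint x : Z.abs_nat (Z_of_zint x) = absz x.
Proof. by case: x => n /=; lia. Qed.

Lemma IZR_zint x : IZR (Z_of_zint x) = (x%:~R)%R.
Proof.
case: x => n; rewrite /Z_of_zint; first by rewrite -INR_IZR_INZ -INR_natr.
by rewrite opp_IZR -INR_IZR_INZ -INR_natr NegzE mulrNz.
Qed.

Lemma Zpartial_zrange f N :
  Zpartial f N = \big[Cplus/RtoC 0]_(x <- zrange N) f (Z_of_zint x).
Proof.
rewrite /zrange big_map /Zpartial -(big_mkord xpredT (fun k => f (Z.sub (Z.of_nat k) (Z.of_nat N)))).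
by rewrite /index_iota subn0; apply: eq_bigr => k _; rewrite Z_of_zintB.
Qed.

Lemma theta_partial (w : int -> R) e (g : nat -> R) M : proper_exp e ->
  sum_n (fun n => theta_fps w e n * g n) M =
  (\sum_(x <- zrange M | (e x <= M)%N) w x * g (e x))%R.
Proof.
move=> pe; rewrite sum_n_Reals sum_f_R0_big.
transitivity (\sum_(i < M.+1) \sum_(x <- zrange M) (if e x == i then w x * g (e x) else 0))%R.
  apply: eq_bigr => i _; rewrite (theta_fps_coef w pe (ltn_ord i : (i <= M)%N)).
  rewrite RmultE mulr_suml big_mkcond; apply: eq_bigr => x _.
  by case: eqP => // ->.
rewrite exchange_big [RHS]big_mkcond; apply: eq_bigr => x _ /=.
have [leM|ltM] := leqP (e x) M.
  have lt : (e x < M.+1)%N by [].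
  rewrite (bigD1 (Ordinal lt)) //= eqxx big1 ?addr0 // => i nei.
  by case: eqP => //= exi; move: nei; rewrite -val_eqE /= -exi eqxx.
by rewrite big1 // => i _; case: eqP => // ex; have := ltn_ord i; lia.
Qed.

(** The coefficient of index [n] adds at most [2 n + 1] weights, each bounded by [(n + 1)^k]; this
    explains the constant 2 and the exponent [k + 1]. *)
Lemma theta_poly_bounded (w : int -> R) e k :
  (forall x, Rabs (w x) <= (INR (absz x) + 1) ^ k) -> poly_bounded (theta_fps w e).
Proof.
move=> wk; exists 2, k.+1; split; first lra.
move=> n; pose X := (INR n + 1) ^ k.
have X0 : 0 <= X by apply: pow_le; have := INR1_ge1 n; lra.
suff bound (s : seq int) : {subset s <= zrange n} ->
    Rabs (\sum_(x <- s | e x == n) w x)%R <= INR (size s) * X.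
  have := bound _ (fun x => id); rewrite size_map size_iota => h.
  apply: Rle_trans h _; rewrite S_INR mult_INR /X /=.
  by have := pos_INR n; rewrite -/X; nra.
elim: s => [|x s IH] sub; first by rewrite big_nil Rabs_R0 /=; lra.
have {}IH := IH (fun y ys => sub y (@mem_behead _ (x :: s) y ys)).
rewrite big_cons [size _]/= S_INR.
case: ifP => _; last by apply: Rle_trans IH _; nra.
apply: Rle_trans (Rabs_triang _ _) _.
have : Rabs (w x) <= X.
  apply: Rle_trans (wk x) _; apply: pow_incr; have := pos_INR (absz x).
  have : INR (absz x) <= INR n.
    by apply: le_INR; apply/leP; rewrite -mem_zrange; apply: sub; rewrite mem_head.
  lra.
by rewrite Rmult_plus_distr_r Rmult_1_l => h; rewrite Rplus_comm; apply: Rplus_le_compat.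
Qed.

Lemma is_series_subseq (a : nat -> R) (l : R) (ph : nat -> nat) :
  filterlim ph eventually eventually -> is_series a l ->
  is_lim_seq (fun N => sum_n a (ph N)) l.
Proof. by move=> sub al; apply: (is_lim_seq_subseq (sum_n a) l ph sub). Qed.

Variables (r : C) (r_lt1 : Cmod r < 1).

(** Since [|x| <= N] is equivalent to [e_int x <= 4 N^2], the symmetric sums are a subsequence of
    the partial sums of the power series. *)
Lemma theta_int_lim (w : int -> R) (f : Z -> C) :
  poly_bounded (theta_fps w e_int) ->
  (forall x, f (Z_of_zint x) = Cmult (RtoC (w x)) (Cpown r (e_int x))) ->
  Clim (Zpartial f) (fps_ev r (theta_fps w e_int)).
Proof.
move=> pw fw.
have sub : filterlim (fun N => 4 * N ^ 2)%N eventually eventually.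
  by apply: eventually_subseq => n; apply/ltP; nia.
have part (g : nat -> R) N : sum_n (fun n => theta_fps w e_int n * g n) (4 * N ^ 2)%N =
    (\sum_(x <- zrange N) w x * g (e_int x))%R.
  rewrite (theta_partial w g _ e_int_proper).
  apply: (eq_big_bij (h := id)); rewrite ?zrange_uniq //.
    by move=> x _ lex; rewrite mem_zrange; split=> //; move: lex; rewrite /e_int; nia.
  move=> x; rewrite mem_zrange => lex _; exists x; rewrite mem_zrange; split=> //.
    nia.
  by rewrite /e_int; nia.
split.
  apply: is_lim_seq_ext (is_series_subseq sub (fps_ev_Re r_lt1 pw)) => N.
  rewrite part Zpartial_zrange Re_big; apply: eq_bigr => x _; rewrite fw /=.
  by rewrite Rmult_0_l Rminus_0_r.
apply: is_lim_seq_ext (is_series_subseq sub (fps_ev_Im r_lt1 pw)) => N.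
rewrite part Zpartial_zrange Im_big; apply: eq_bigr => x _; rewrite fw /=.
by rewrite Rmult_0_l Rplus_0_r.
Qed.

(* The symmetric window [-N, N] omits the index [-N-1], whose exponent equals
   that of [N]; its term tends to 0. *)
Lemma theta_half_lim (w : int -> R) (f : Z -> C) :
  poly_bounded (theta_fps w e_half) -> (forall x, w x = 1) ->
  (forall x, f (Z_of_zint x) = Cmult (RtoC (w x)) (Cpown r (e_half x))) ->
  Clim (Zpartial f) (fps_ev r (theta_fps w e_half)).
Proof.
move=> pw w1 fw; pose ph N := ((2 * N + 1) ^ 2)%N.
have sub : filterlim ph eventually eventually.
  by apply: eventually_subseq => n; apply/ltP; rewrite /ph; nia.
have part (g : nat -> R) N : sum_n (fun n => theta_fps w e_half n * g n) (ph N) - g (ph N) =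
    (\sum_(x <- zrange N) w x * g (e_half x))%R.
  rewrite (theta_partial w g _ e_half_proper).
  have -> : (\sum_(x <- zrange (ph N) | (e_half x <= ph N)%N) w x * g (e_half x) =
      \sum_(x <- (- N%:Z - 1) :: zrange N) w x * g (e_half x))%R.
    apply: (eq_big_bij (h := id)); rewrite ?zrange_uniq //.
    - by rewrite cons_uniq zrange_uniq mem_zrange andbT; lia.
    - move=> x _ lex; split=> //; rewrite inE mem_zrange.
      by move: lex; rewrite /e_half /ph leq_sqr; lia.
    - move=> x xs _; exists x; rewrite mem_zrange /e_half /ph leq_sqr.
      by move: xs; rewrite inE mem_zrange => xs; split=> //; nia.
  rewrite big_cons.
  have -> : e_half (- N%:Z - 1)%R = ph N by rewrite /e_half /ph; congr (_ ^ _)%N; lia.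
  by rewrite w1 mul1r RminusE addrAC subrr add0r.
have lim0 (g : nat -> R) : (forall n, Rabs (g n) <= Cmod r ^ n) ->
    is_lim_seq (fun N => g (ph N)) 0.
  move=> hg; apply: (is_lim_seq_subseq g 0 ph sub); apply: ex_series_lim_0.
  apply: ex_series_Rabs.
  apply: ex_series_ext (fps_ev_abs r_lt1 (@poly_bounded_finite (Fps (fun=> 1)) 1 _) hg).
    by move=> n /=; rewrite Rmult_1_l.
  by move=> n /=; rewrite Rabs_R1; right.
split.
  have L := is_lim_seq_minus' _ _ _ _
    (is_series_subseq sub (fps_ev_Re r_lt1 pw)) (lim0 _ (Re_Cpown_le r)).
  rewrite Rminus_0_r in L; apply: is_lim_seq_ext L => N.
  rewrite part Zpartial_zrange Re_big; apply: eq_bigr => x _; rewrite fw /=.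
  by rewrite Rmult_0_l Rminus_0_r.
have L := is_lim_seq_minus' _ _ _ _
  (is_series_subseq sub (fps_ev_Im r_lt1 pw)) (lim0 _ (Im_Cpown_le r)).
rewrite Rminus_0_r in L; apply: is_lim_seq_ext L => N.
rewrite part Zpartial_zrange Im_big; apply: eq_bigr => x _; rewrite fw /=.
by rewrite Rmult_0_l Rplus_0_r.
Qed.

End ThetaValues.

(** * Moment series as iterated derivatives of [t3] *)

Section Moments.
Local Open Scope ring_scope.
Variable K : numDomainType.

Definition moment_fps k : fps K := theta_fps (fun x => x%:~R ^+ k) e_int.

Lemma moment_fps0 : moment_fps 0 = t3 K. Proof. by []. Qed.

(** The derivation multiplies the term of index [x] by its exponent [4 x^2]. *)
Lemma fps_D_moment k : fps_D (moment_fps k) = 4%:R * moment_fps k.+2.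
Proof.
apply: fpsP => n; rewrite coefs_natM /= !mulr_sumr; apply: eq_bigr => x /eqP <-.
have -> : ((e_int x)%:R = 4%:R * x%:~R ^+ 2 :> K).
  by rewrite -[LHS]/((e_int x)%:Z%:~R) e_intZ intrM rmorphXn.
by rewrite -mulrA -exprD add2n.
Qed.

Lemma moment_fps_odd k : odd k -> moment_fps k = 0.
Proof.
move=> odk; apply: fpsP => n.
have E : moment_fps k n = - moment_fps k n.
  rewrite [in RHS]/= -sumrN; apply: (eq_big_bij (h := -%R)); rewrite ?zrange_uniq //.
  - exact: oppr_inj.
  - move=> x; rewrite !mem_zrange /e_int abszN => xn en; split=> //.
    by rewrite rmorphN exprNn -signr_odd odk expr1 mulN1r opprK.
  - move=> y; rewrite !mem_zrange /e_int => yn en; exists (- y).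
    by rewrite mem_zrange abszN opprK.
apply/eqP; move/eqP: E; rewrite -subr_eq0 opprK -mulr2n.
by rewrite Num.Theory.mulrn_eq0.
Qed.

End Moments.

(** * The thetas and the moments at a point of the upper half plane *)

Section ThetaPoint.
Local Open Scope R_scope.

Lemma cexpD v w : cexp (Cplus v w) = Cmult (cexp v) (cexp w).
Proof.
case: v w => [a b] [c d]; rewrite /cexp /Cmult /= exp_plus cos_plus sin_plus.
by congr pair; ring.
Qed.

Lemma cexp0 : cexp (RtoC 0) = RtoC 1.
Proof. by rewrite /cexp /= exp_0 cos_0 sin_0; congr pair; ring. Qed.

Lemma Cpown_cexp w n : Cpown (cexp w) n = cexp (Cmult (RtoC (INR n)) w).
Proof.
elim: n => [|n IH]; first by rewrite Cmult0 cexp0.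
by rewrite CpownS IH S_INR -cexpD RtoC_plus; congr cexp; ring.
Qed.

Lemma Cmod_cexp w : Cmod (cexp w) = exp (Re w).
Proof.
rewrite /Cmod /cexp /=.
set s := sin _; set c := cos _; set E := exp _.
have -> : E * c * (E * c * 1) + E * s * (E * s * 1) = E * E * (s * s + c * c) by ring.
have -> : s * s + c * c = 1 by exact: sin2_cos2.
by rewrite Rmult_1_r; apply: sqrt_square; apply: Rlt_le; apply: exp_pos.
Qed.

Variables (z : C) (z_upper : 0 < Im z).
(** The fourth root of [q] determined by [z], the same branch as in the powers [qpow] that define
    [theta2]. *)
Local Notation r := (qpow z (/ 4)).

Lemma r_lt1 : Cmod r < 1.
Proof.
rewrite Cmod_cexp -exp_0; apply: exp_increasing; move: z_upper; case: z => x y /= hy.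
have := PI_RGT_0; nra.
Qed.

Lemma qC_r : qC z = Cpown r 4.
Proof.
rewrite Cpown_cexp /qC; congr cexp.
have -> : RtoC (INR 4) = RtoC 4 by congr RtoC; rewrite /=; ring.
rewrite RtoC_mult; have -> : RtoC (/ 4) = Cinv (RtoC 4) by rewrite RtoC_inv //; lra.
by field; move=> /RtoC_inj; lra.
Qed.

Lemma Cpown_qC n : Cpown (qC z) n = Cpown r (4 * n).
Proof. by rewrite qC_r CpownM. Qed.

Lemma qpow_half x : qpow z ((IZR (Z_of_zint x) + / 2) ^ 2) = Cpown r (e_half x).
Proof.
rewrite Cpown_cexp /qpow; congr cexp.
have -> : INR (e_half x) = (2 * IZR (Z_of_zint x) + 1) ^ 2.
  rewrite IZR_zint -INR_natr.
  rewrite -[LHS]/(((e_half x)%:Z%:~R)%R : R) e_halfZ !rmorphXn rmorphD rmorphM /=.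
  by rewrite -[RHS]/((_ + _) * ((_ + _) * 1)) expr2 Rmult_1_r.
set t := IZR _.
have -> : PI * (t + / 2) ^ 2 = (2 * t + 1) ^ 2 * (PI * / 4) by field.
by rewrite RtoC_mult; ring.
Qed.

Lemma moment_bounded k : poly_bounded (moment_fps R k).
Proof.
apply: (@theta_poly_bounded _ _ k) => x.
rewrite -[(_ ^+ k)%R]RpowE -RPow_abs; apply: pow_incr; split; first exact: Rabs_pos.
rewrite -IZR_zint -abs_nat_zint INR_IZR_INZ Zabs2Nat.id_abs abs_IZR; lra.
Qed.

Lemma t2_bounded : poly_bounded (t2 R).
Proof. by apply: (@theta_poly_bounded _ _ 0) => x /=; rewrite Rabs_R1; right. Qed.
Lemma t3_bounded : poly_bounded (t3 R).
Proof. exact: (moment_bounded 0). Qed.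
Lemma t4_bounded : poly_bounded (t4 R).
Proof.
apply: (@theta_poly_bounded _ _ 0) => x /=; right.
by rewrite -[(_ ^+ _)%R]RpowE -RPow_abs -[(-1)%R]/(- (1)) Rabs_Ropp Rabs_R1 pow1.
Qed.

Definition moment k := fps_ev r (moment_fps R k).

Lemma moment_lim k :
  Clim (Zpartial (fun m => Cmult (RtoC (IZR m ^ k)) (Cpown (qC z) (Z.abs_nat m ^ 2))))
    (moment k).
Proof.
apply: (theta_int_lim r_lt1 (moment_bounded k)) => x.
by rewrite abs_nat_zint Cpown_qC IZR_zint RpowE.
Qed.

Lemma moment_odd k : odd k -> moment k = RtoC 0.
Proof. by move=> odk; rewrite /moment moment_fps_odd // (fps_ev_nat r_lt1 0). Qed.

Lemma theta3_ev : theta3 z = moment 0.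
Proof.
apply: Zsum_lim; apply: (theta_int_lim r_lt1 (moment_bounded 0)) => x.
by rewrite abs_nat_zint Cpown_qC expr0 Cmult1.
Qed.

Lemma theta4_ev : theta4 z = fps_ev r (t4 R).
Proof.
apply: Zsum_lim; apply: (theta_int_lim r_lt1 t4_bounded) => x.
rewrite abs_nat_zint.
have -> : Copp (qC z) = Cmult (RtoC (-1)) (qC z) by ring.
rewrite Cpown_mul Cpown_qC; congr (Cmult _ _).
have -> n : Cpown (RtoC (-1)) n = RtoC ((-1) ^+ n)%R.
  elim: n => [|n IH]; first by rewrite expr0.
  by rewrite CpownS IH exprS -RtoC_mult.
by congr RtoC; rewrite -signr_odd oddX /= signr_odd.
Qed.

Lemma theta2_ev : theta2 z = fps_ev r (t2 R).
Proof.
apply: Zsum_lim; apply: (theta_half_lim r_lt1 t2_bounded) => // x.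
by rewrite qpow_half Cmult1.
Qed.

End ThetaPoint.

(** * The two moment identities as equations between complex numbers *)

Section MomentIdentities.
Local Open Scope R_scope.
Variables (z : C) (z_upper : 0 < Im z).
Local Notation r := (qpow z (/ 4)).
Local Notation s := (moment z).

Lemma Cpown0 w : Cpown w 0 = RtoC 1. Proof. by []. Qed.
Lemma RtoC4E : RtoC 4 = Cmult (RtoC 2) (RtoC 2).
Proof. by rewrite -RtoC_mult; congr RtoC; ring. Qed.
Lemma RtoC8E : RtoC 8 = Cmult (RtoC 2) (Cmult (RtoC 2) (RtoC 2)).
Proof. by rewrite -!RtoC_mult; congr RtoC; ring. Qed.
Lemma RtoC16E : RtoC 16 = Cmult (Cmult (RtoC 2) (RtoC 2)) (Cmult (RtoC 2) (RtoC 2)).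
Proof. by rewrite -!RtoC_mult; congr RtoC; ring. Qed.
Lemma RtoC64E : RtoC 64 = Cmult (Cmult (Cmult (RtoC 2) (RtoC 2)) (Cmult (RtoC 2) (RtoC 2)))
  (Cmult (RtoC 2) (RtoC 2)).
Proof. by rewrite -!RtoC_mult; congr RtoC; ring. Qed.

Lemma Cmult_cancel (c : R) x y : c <> 0 -> Cmult (RtoC c) x = Cmult (RtoC c) y -> x = y.
Proof.
move=> c0 H; have := congr1 (Cmult (Cinv (RtoC c))) H.
by rewrite !CmultA Cinv_l ?Cmult1 // => /RtoC_inj.
Qed.

Lemma D_t3_moments :
  [/\ fps_D (t3 R) = (4%:R * moment_fps R 2)%R,
      fps_D (fps_D (t3 R)) = (16%:R * moment_fps R 4)%R
    & fps_D (fps_D (fps_D (t3 R))) = (64%:R * moment_fps R 6)%R].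
Proof.
have Dn k (f : fps R) : fps_D (k%:R * f)%R = (k%:R * fps_D f)%R.
  by rewrite fps_DM fps_D_nat mul0r add0r.
rewrite -moment_fps0 fps_D_moment; split=> //.
  by rewrite Dn fps_D_moment mulrA -natrM.
by rewrite !(Dn, fps_D_moment) !mulrA -!natrM.
Qed.

Ltac bounded := repeat first
  [ exact: t2_bounded | exact: t3_bounded | exact: t4_bounded
  | exact: moment_bounded | exact: poly_bounded_nat
  | apply: poly_boundedX | apply: poly_boundedB | apply: poly_boundedD
  | apply: poly_boundedM ].

(** The derivatives of [t3] bring a factor 16 on the left; on the right [theta2^4 theta4^4] is
    [16 Delta8], and the 2 of [t3_degree4] remains. *)
Lemma moment_degree4 :
  Cminus (Cmult (s 4) (s 0)) (Cmult (RtoC 3) (Cmult (s 2) (s 2))) =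
  Cmult (RtoC 2) (Cmult (Delta8 z) (Cmult (s 0) (s 0))).
Proof.
have r1 := r_lt1 z_upper.
have [E1 E2 _] := D_t3_moments.
have := congr1 (fps_ev r) (t3_degree4 R); rewrite E2 E1.
rewrite !(fps_ev_nat r1, fps_evX r1, fps_evB r1, fps_evM r1); try by bounded.
rewrite -theta2_ev // -theta4_ev // -moment_fps0 -/(s 0) -/(s 2) -/(s 4) /Delta8.
set T2 := theta2 z; set T4 := theta4 z; rewrite !CpownS.
rewrite !Cpown0 !INR_IZR_INZ /= RtoC16E RtoC4E => E.
apply: (@Cmult_cancel 16); first lra; rewrite RtoC16E.
match type of E with ?x = ?y => transitivity x; [|rewrite E] end; last first.
  by field; move/RtoC_inj; lra.
ring.
Qed.

(** Here the left side carries 64 and the right side [8 * 16], which again leaves 2. *)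
Lemma moment_degree6 :
  Cplus (Cminus (Cmult (s 6) (Cmult (s 0) (s 0)))
    (Cmult (RtoC 15) (Cmult (s 4) (Cmult (s 2) (s 0)))))
    (Cmult (RtoC 30) (Cmult (s 2) (Cmult (s 2) (s 2)))) =
  Cmult (RtoC 2) (Cmult (varphi z) (Cmult (Delta8 z) (Cmult (s 0) (Cmult (s 0) (s 0))))).
Proof.
have r1 := r_lt1 z_upper.
have [E1 E2 E3] := D_t3_moments.
have := congr1 (fps_ev r) (t3_degree6 R); rewrite E3 E2 E1.
rewrite !(fps_ev_nat r1, fps_evX r1, fps_evB r1, fps_evD r1, fps_evM r1); try by bounded.
rewrite -theta2_ev // -theta4_ev // -moment_fps0 -/(s 0) -/(s 2) -/(s 4) -/(s 6).
rewrite /Delta8 /varphi.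
set T2 := theta2 z; set T4 := theta4 z; rewrite !CpownS.
rewrite !Cpown0 !INR_IZR_INZ /= RtoC64E RtoC16E RtoC8E RtoC4E => E.
apply: (@Cmult_cancel 64); first lra; rewrite RtoC64E.
match type of E with ?x = ?y => transitivity x; [|rewrite E] end; last first.
  by field; move/RtoC_inj; lra.
ring.
Qed.

End MomentIdentities.

(** * Separation of variables in the lattice sum *)

Section LatticeSum.
Local Open Scope ring_scope.
Variables (n : nat) (z : C) (z_upper : Rlt 0 (Im z)).
Implicit Type P : {mpoly R[n]}.

Lemma RtoC_sum (I : Type) (s : seq I) (F : I -> R) :
  RtoC (\sum_(i <- s) F i) = \big[Cplus/RtoC 0]_(i <- s) RtoC (F i).
Proof. by apply: big_morph => // x y; exact: RtoC_plus. Qed.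
Lemma RtoC_prod (I : Type) (s : seq I) (F : I -> R) :
  RtoC (\prod_(i <- s) F i) = \big[Cmult/RtoC 1]_(i <- s) RtoC (F i).
Proof. by apply: big_morph => // x y; exact: RtoC_mult. Qed.
Lemma Cpown_sum w (I : Type) (s : seq I) (F : I -> nat) :
  Cpown w (\sum_(i <- s) F i)%N = \big[Cmult/RtoC 1]_(i <- s) Cpown w (F i).
Proof. by apply: (big_morph (Cpown w)) => // i j; exact: CpownD. Qed.

(** Abstract in the sequence [s], so that one expression covers the partial sums over cubes and, by
    continuity, their limits. *)
Definition theta_sum (s : nat -> C) P : C :=
  \big[Cplus/RtoC 0]_(m <- msupp P)
    Cmult (RtoC P@_m) (\big[Cmult/RtoC 1]_(i < n) s (m i)).

Lemma thetaZn_termE P (x : 'I_n -> Z) : thetaZn_term P z x =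
  \big[Cplus/RtoC 0]_(m <- msupp P) Cmult (RtoC P@_m) (\big[Cmult/RtoC 1]_(i < n)
    Cmult (RtoC (pow (IZR (x i)) (m i))) (Cpown (qC z) (Z.abs_nat (x i) ^ 2))).
Proof.
rewrite /thetaZn_term mevalE RtoC_sum big_distrl; apply: eq_bigr => m _ /=.
rewrite (RtoC_mult P@_m) -CmultA RtoC_prod /sqnorm Cpown_sum -big_split /=.
by congr (Cmult _ _); apply: eq_bigr => i _; rewrite RpowE.
Qed.

(** The cube is a product of windows, so each partial sum factors exactly and no infinite sum has to
    be rearranged. *)
Lemma Znpartial_theta P N :
  Znpartial (thetaZn_term P z) N =
  theta_sum (fun k => Zpartial (fun m =>
    Cmult (RtoC (pow (IZR m) k)) (Cpown (qC z) (Z.abs_nat m ^ 2))) N) P.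
Proof.
rewrite /Znpartial /theta_sum.
rewrite (eq_bigr _ (fun k _ => thetaZn_termE P _)) exchange_big /=.
apply: eq_bigr => m _.
by rewrite /Zpartial bigA_distr_bigA big_distrr.
Qed.

Lemma Znsum_theta P : Znsum_to (thetaZn_term P z) (theta_sum (moment z) P).
Proof.
apply: Clim_filterlim.
apply: (Clim_ext (fun N => esym (Znpartial_theta P N))).
apply: Clim_sum => m; apply: Clim_mult; first exact: Clim_const.
by apply: Clim_prod => i; apply: moment_lim.
Qed.

End LatticeSum.

(** * Linear functionals on coefficients and the transposed Laplacian *)

Section CoefficientFunctionals.
Local Open Scope ring_scope.
Variables (n : nat).
Implicit Types (P Q : {mpoly R[n]}) (m : 'X_{1..n}) (i : 'X_{1..n} -> R).

Definition coef_sum i P : R := \sum_(m <- msupp P) P@_m * i m.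

(** The support changes with [P]; linearity is proved over an index set common to [P], [Q] and their
    combination. *)
Lemma coef_sumwE i P k : (msize P <= k)%N ->
  coef_sum i P = \sum_(m : 'X_{1..n < k}) P@_m * i m.
Proof.
pose I : subFinType _ := 'X_{1..n < k}.
move=> lek; rewrite /coef_sum (ssrcomplements.big_mksub I) ?msupp_uniq //=; first last.
  by move=> m /msize_mdeg_lt /leq_trans; apply.
by rewrite big_rmcond //= => m /memN_msupp_eq0 ->; rewrite mul0r.
Qed.

Lemma coef_sum_linear i a P Q : coef_sum i (a *: P + Q) = a * coef_sum i P + coef_sum i Q.
Proof.
pose k := maxn (msize (a *: P + Q)) (maxn (msize P) (msize Q)).
rewrite !(@coef_sumwE i _ k) ?leq_max ?leqnn ?orbT //.
rewrite mulr_sumr -big_split /=; apply: eq_bigr => m _.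
by rewrite mcoeffD mcoeffZ mulrDl mulrA.
Qed.

Lemma coef_sum0 i : coef_sum i 0 = 0.
Proof. by rewrite /coef_sum msupp0 big_nil. Qed.
Lemma coef_sumD i P Q : coef_sum i (P + Q) = coef_sum i P + coef_sum i Q.
Proof. by have := coef_sum_linear i 1 P Q; rewrite scale1r mul1r. Qed.
Lemma coef_sumZ i a P : coef_sum i (a *: P) = a * coef_sum i P.
Proof. by have := coef_sum_linear i a P 0; rewrite coef_sum0 !addr0. Qed.
Lemma coef_sum_sum i (I : Type) (s : seq I) (F : I -> {mpoly R[n]}) :
  coef_sum i (\sum_(j <- s) F j) = \sum_(j <- s) coef_sum i (F j).
Proof. by apply: big_morph; [exact: coef_sumD | exact: coef_sum0]. Qed.
Lemma coef_sumX i m : coef_sum i 'X_[m] = i m.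
Proof. by rewrite /coef_sum msuppX big_seq1 mcoeffX eqxx mul1r. Qed.

(** The transpose of the Laplacian on weights. Where the subtraction of [U_(l) *+ 2] truncates, the
    factor [m l * (m l).-1] is 0. *)
Definition dual_laplacian i m : R :=
  \sum_(l < n) (m l * (m l).-1)%:R * i (m - U_(l) *+ 2)%MM.

Lemma laplacianX m :
  laplacian 'X_[m] = \sum_(l < n) (m l * (m l).-1)%:R *: 'X_[R, m - U_(l) *+ 2].
Proof.
apply: eq_bigr => l _; rewrite mderivX mderivZ mderivX scalerA -natrM.
congr (_%:R *: 'X_[_]); first by rewrite mnmBE mnm1E eqxx subn1.
by apply/mnmP => j; rewrite !mnmE; lia.
Qed.

Lemma laplacianD P Q : laplacian (P + Q) = laplacian P + laplacian Q.
Proof. by rewrite /laplacian -big_split; apply: eq_bigr => l _; rewrite !mderivD. Qed.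
Lemma laplacianZ a P : laplacian (a *: P) = a *: laplacian P.
Proof. by rewrite /laplacian scaler_sumr; apply: eq_bigr => l _; rewrite !mderivZ. Qed.
Lemma laplacian0 : laplacian (0 : {mpoly R[n]}) = 0.
Proof. by rewrite /laplacian big1 // => l _; rewrite !mderiv0. Qed.

Lemma coef_sum_laplacian i P : coef_sum i (laplacian P) = coef_sum (dual_laplacian i) P.
Proof.
rewrite {1}(mpolyE P) (big_morph (@laplacian n) laplacianD laplacian0) coef_sum_sum.
apply: eq_bigr => m _; rewrite laplacianZ coef_sumZ laplacianX coef_sum_sum.
by congr (_ * _); apply: eq_bigr => l _; rewrite coef_sumZ coef_sumX.
Qed.

Lemma eq_coef_sum d i j P : P \is d.-homog ->
  (forall m, mdeg m = d -> i m = j m) -> coef_sum i P = coef_sum j P.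
Proof.
move=> /dhomogP hP ij; rewrite /coef_sum !big_seq; apply: eq_bigr => m mP.
by rewrite ij //; apply: hP.
Qed.

(* In degree at most 6, the shape of an even monomial (as a partition) is
   determined by the sum of the squares of its exponents: 4 for (2); 16, 8 for
   (4), (2,2); 36, 20, 12 for (6), (4,2), (2,2,2). *)
Definition even_mnm m := [forall l, ~~ odd (m l)].
Definition mnm_sumsq m := (\sum_(l < n) m l ^ 2)%N.
Definition type_ind (t : nat) m : R := (even_mnm m && (mnm_sumsq m == t))%:R.

Lemma even_mnm_sub m l : (1 < m l)%N -> even_mnm (m - U_(l) *+ 2)%MM = even_mnm m.
Proof.
move=> ml; apply: eq_forallb => j; rewrite mnmBE mulmnE mnm1E.
by case: (l =P j) => [<-|_]; [rewrite mul1n oddB // addbF | rewrite mul0n subn0].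
Qed.

Lemma mnm_sumsq_sub m l : (1 < m l)%N ->
  (mnm_sumsq (m - U_(l) *+ 2)%MM + 4 * m l = mnm_sumsq m + 4)%N.
Proof.
move=> ml; rewrite /mnm_sumsq (bigD1 l) // [in RHS](bigD1 l) //=.
rewrite (eq_bigr (fun j => m j ^ 2)%N) => [|j /negbTE nej]; last first.
  by rewrite mnmBE mulmnE mnm1E eq_sym nej mul0n subn0.
by rewrite mnmBE mulmnE mnm1E eqxx; move: (\sum_(_ < n | _) _)%N => S; nia.
Qed.

(** Lowering [m l] by two preserves parity and lowers the sum of squares by [4 m l - 4]; the test is
    written additively to avoid truncation. *)
Lemma dual_laplacian_type t m : dual_laplacian (type_ind t) m =
  (if even_mnm m then
    \sum_(l < n) m l * (m l).-1 * (mnm_sumsq m + 4 == t + 4 * m l)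
  else 0)%N%:R.
Proof.
have E l : (m l * (m l).-1)%:R * type_ind t (m - U_(l) *+ 2)%MM =
  (m l * (m l).-1)%:R * (even_mnm m && (mnm_sumsq m + 4 == t + 4 * m l)%N)%:R :> R.
  have [le1|ml] := leqP (m l) 1.
    have -> : (m l * (m l).-1 = 0)%N by nia.
    by rewrite !mul0r.
  by rewrite /type_ind even_mnm_sub // -(mnm_sumsq_sub ml) eqn_add2r.
rewrite /dual_laplacian; case: ifP => ev.
  by rewrite natr_sum; apply: eq_bigr => l _; rewrite E ev -natrM.
by rewrite big1 // => l _; rewrite E ev mulr0.
Qed.

(** [w] is the shape of [m] as a partition. The bound on [size w] is what excludes shapes with more
    than [n] parts. *)
Definition zero_padded (w : seq nat) m :=
  (size w <= n)%N /\ perm_eq m (w ++ nseq (n - size w) 0%N).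

Lemma big_zero_padded (T : Type) (idx : T) (op : Monoid.com_law idx) (g : nat -> T) w m :
  zero_padded w m ->
  \big[op/idx]_(l < n) g (m l) =
  op (\big[op/idx]_(x <- w) g x) (iter (n - size w) (op (g 0%N)) idx).
Proof.
move=> [_ pm]; transitivity (\big[op/idx]_(x <- m) g x).
  by rewrite big_tuple; apply: eq_bigr => l _; rewrite mnm_tnth.
by rewrite (perm_big _ pm) big_cat big_nseq.
Qed.

Lemma even_profile m : even_mnm m -> exists w, zero_padded w m /\
  [/\ all (fun x => ~~ odd x && (0 < x)%N) w & sumn w = mdeg m].
Proof.
move=> /forallP ev; pose w := [seq x <- m | x != 0%N]; exists w.
have pm : perm_eq m (w ++ [seq x <- m | predC (fun x => x != 0%N) x]).
  by rewrite perm_sym perm_filterC.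
have szm := perm_size pm; rewrite size_tuple size_cat in szm.
have zeros : [seq x <- m | predC (fun x => x != 0%N) x] = nseq (n - size w) 0%N.
  have -> : (n - size w)%N = size [seq x <- m | predC (fun x => x != 0%N) x].
    by move: szm; rewrite -/w; lia.
  by apply/all_pred1P/allP => x; rewrite mem_filter /= negbK; case/andP.
split.
  split; last by rewrite -zeros.
  by have := leq_addr (size [seq x <- m | predC (fun x => x != 0%N) x]) (size w); rewrite -szm.
split.
  apply/allP => x; rewrite mem_filter => /andP[x0 /tnthP[l xl]].
  by rewrite lt0n x0 andbT xl -mnm_tnth ev.
rewrite mdegE; have := perm_sumn pm; rewrite sumn_cat zeros sumn_nseq mul0n addn0 => <-.
by rewrite sumnE big_tuple; apply: eq_bigr => l _; rewrite mnm_tnth.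
Qed.

End CoefficientFunctionals.

(** * Relations between the shape sums of a harmonic polynomial *)

Section HarmonicRelations.
Local Open Scope ring_scope.
Variable n : nat.
Implicit Types (P Q : {mpoly R[n]}) (m : 'X_{1..n}).

Lemma zero_padded_perm w w' m : perm_eq w w' -> zero_padded w m -> zero_padded w' m.
Proof.
move=> ww' [szw pm]; rewrite /zero_padded -(perm_size ww'); split=> //.
by apply: perm_trans pm _; rewrite perm_cat2r.
Qed.

Lemma profile2 m : even_mnm m -> mdeg m = 2%N -> zero_padded [:: 2]%N m.
Proof.
move=> /even_profile [w [zw [aw sw]]] dm; rewrite dm in sw.
case: w zw aw sw => [|x [|y w]] zw //=.
  by rewrite andbT addn0 => _ sx; rewrite sx in zw.
by move=> aw sw; exfalso; lia.
Qed.

Lemma profile4 m : even_mnm m -> mdeg m = 4%N ->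
  zero_padded [:: 4]%N m \/ zero_padded [:: 2; 2]%N m.
Proof.
move=> /even_profile [w [zw [aw sw]]] dm; rewrite dm in sw.
case: w zw aw sw => [|x [|y [|t w]]] zw //=.
- by rewrite andbT addn0 => _ sx; rewrite sx in zw; left.
- move=> aw sw; right; have [xE yE] : x = 2%N /\ y = 2%N by lia.
  by rewrite xE yE in zw.
- by move=> aw sw; exfalso; lia.
Qed.

Lemma profile6 m : even_mnm m -> mdeg m = 6%N ->
  [\/ zero_padded [:: 6]%N m, zero_padded [:: 4; 2]%N m | zero_padded [:: 2; 2; 2]%N m].
Proof.
move=> /even_profile [w [zw [aw sw]]] dm; rewrite dm in sw.
case: w zw aw sw => [|x [|y [|t [|t' w]]]] zw //=.
- by rewrite andbT addn0 => _ sx; rewrite sx in zw; constructor 1.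
- move=> aw sw; constructor 2.
  have [[xE yE]|[xE yE]] : (x = 4 /\ y = 2)%N \/ (x = 2 /\ y = 4)%N by lia.
    by rewrite xE yE in zw.
  by rewrite xE yE in zw; apply: zero_padded_perm zw.
- move=> aw sw; constructor 3; have [xE [yE tE]] : (x = 2 /\ y = 2 /\ t = 2)%N by lia.
  by rewrite xE yE tE in zw.
- by move=> aw sw; exfalso; lia.
Qed.

Lemma sum_zero_padded (g : nat -> nat) w m : g 0%N = 0%N -> zero_padded w m ->
  (\sum_(l < n) g (m l) = \sum_(x <- w) g x)%N.
Proof.
move=> g0 zw; rewrite (big_zero_padded _ g zw) g0.
by elim: (n - size w)%N => [|k IH] /=; rewrite ?addn0 //= add0n.
Qed.

Lemma prod_zero_padded (s : nat -> C) w m : zero_padded w m ->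
  \big[Cmult/RtoC 1]_(l < n) s (m l) =
  Cmult (\big[Cmult/RtoC 1]_(x <- w) s x) (Cpown (s 0%N) (n - size w)).
Proof.
move=> zw; rewrite (big_zero_padded _ s zw); congr (Cmult _ _).
by elim: (n - size w)%N => [|k IH] //=; rewrite IH.
Qed.

Lemma sumsq_zero_padded w m : zero_padded w m -> mnm_sumsq m = (\sum_(x <- w) x ^ 2)%N.
Proof. exact: (@sum_zero_padded (fun x => x ^ 2)%N). Qed.

Lemma type_ind_zero_padded t w m : even_mnm m -> zero_padded w m ->
  type_ind t m = ((\sum_(x <- w) x ^ 2)%N == t)%:R.
Proof. by move=> ev zw; rewrite /type_ind ev (sumsq_zero_padded zw). Qed.

Lemma type_ind_odd t m : ~~ even_mnm m -> type_ind t m = 0.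
Proof. by rewrite /type_ind => /negbTE ->. Qed.

Lemma dual_laplacian_odd t m : ~~ even_mnm m -> dual_laplacian (type_ind t) m = 0.
Proof. by rewrite dual_laplacian_type => /negbTE ->. Qed.

Lemma dual_laplacian_zero_padded t w m : even_mnm m -> zero_padded w m ->
  dual_laplacian (type_ind t) m =
  (\sum_(x <- w) x * x.-1 * (\sum_(y <- w) y ^ 2 + 4 == t + 4 * x))%N%:R.
Proof.
move=> ev zw; rewrite dual_laplacian_type ev (sumsq_zero_padded zw).
by rewrite (@sum_zero_padded (fun x => x * x.-1 * (\sum_(y <- w) y ^ 2 + 4 == t + 4 * x))%N w m).
Qed.

Ltac eval_types ev zw :=
  rewrite ?(dual_laplacian_zero_padded _ ev zw) ?(type_ind_zero_padded _ ev zw)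
    ?(big_cons, big_nil) -?natrM -?natrD; congr (_%:R); by [].

Lemma dual_laplacian_deg2 m : mdeg m = 2%N ->
  dual_laplacian (type_ind 0) m = 2%:R * type_ind 4 m.
Proof.
move=> dm; have [ev|od] := boolP (even_mnm m); last first.
  by rewrite dual_laplacian_odd // type_ind_odd // mulr0.
have zw := profile2 ev dm; eval_types ev zw.
Qed.

(** The Laplacian sends [x^4] to [12 x^2] and [x^2 y^2] to [2 x^2 + 2 y^2], whence 12 and
    [2 + 2]. *)
Lemma dual_laplacian_deg4 m : mdeg m = 4%N ->
  dual_laplacian (type_ind 4) m = 12%:R * type_ind 16 m + 4%:R * type_ind 8 m.
Proof.
move=> dm; have [ev|od] := boolP (even_mnm m); last first.
  by rewrite dual_laplacian_odd // !type_ind_odd // !mulr0 addr0.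
by case: (profile4 ev dm) => zw; eval_types ev zw.
Qed.

Lemma dual_laplacian_deg6_type16 m : mdeg m = 6%N ->
  dual_laplacian (type_ind 16) m = 30%:R * type_ind 36 m + 2%:R * type_ind 20 m.
Proof.
move=> dm; have [ev|od] := boolP (even_mnm m); last first.
  by rewrite dual_laplacian_odd // !type_ind_odd // !mulr0 addr0.
by case: (profile6 ev dm) => zw; eval_types ev zw.
Qed.

(** Terms of shape (2,2) come from [x^4 y^2], with coefficient 12, and from [x^2 y^2 z^2], three
    times with coefficient 2. *)
Lemma dual_laplacian_deg6_type8 m : mdeg m = 6%N ->
  dual_laplacian (type_ind 8) m = 12%:R * type_ind 20 m + 6%:R * type_ind 12 m.
Proof.
move=> dm; have [ev|od] := boolP (even_mnm m); last first.
  by rewrite dual_laplacian_odd // !type_ind_odd // !mulr0 addr0.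
by case: (profile6 ev dm) => zw; eval_types ev zw.
Qed.

Lemma type_ind8_small m : (n < 2)%N -> mdeg m = 4%N -> type_ind 8 m = 0.
Proof.
move=> n2 dm; have [ev|od] := boolP (even_mnm m); last by rewrite type_ind_odd.
case: (profile4 ev dm) => zw; first by rewrite (type_ind_zero_padded _ ev zw) big_seq1.
by case: zw => /= szw; exfalso; lia.
Qed.

Lemma type_ind12_small m : (n < 3)%N -> mdeg m = 6%N -> type_ind 12 m = 0.
Proof.
move=> n3 dm; have [ev|od] := boolP (even_mnm m); last by rewrite type_ind_odd.
case: (profile6 ev dm) => zw.
- by rewrite (type_ind_zero_padded _ ev zw) big_seq1.
- by rewrite (type_ind_zero_padded _ ev zw) !(big_cons, big_nil).
- by case: zw => /= szw; exfalso; lia.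
Qed.

Lemma coef_sum_comb a b i j P :
  coef_sum (fun m => a * i m + b * j m) P = a * coef_sum i P + b * coef_sum j P.
Proof.
rewrite /coef_sum !mulr_sumr -big_split /=; apply: eq_bigr => m _.
by rewrite mulrDr !mulrA ![P@_m * _]mulrC.
Qed.

Lemma coef_sum_scal a i P : coef_sum (fun m => a * i m) P = a * coef_sum i P.
Proof. by rewrite /coef_sum mulr_sumr; apply: eq_bigr => m _; rewrite mulrCA. Qed.

Lemma harm_coef_sum d i P : harm d P -> coef_sum (dual_laplacian i) P = 0.
Proof. by case=> _ lP; rewrite -coef_sum_laplacian lP coef_sum0. Qed.

Lemma harm2_rel P : harm 2 P -> coef_sum (type_ind 4) P = 0.
Proof.
move=> hP; have := harm_coef_sum (type_ind 0) hP.
rewrite (eq_coef_sum hP.1 dual_laplacian_deg2) coef_sum_scal => /eqP.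
by rewrite mulf_eq0 Num.Theory.pnatr_eq0 => /eqP.
Qed.

Lemma harm4_rel P : harm 4 P ->
  coef_sum (type_ind 8) P = Rmult (-3) (coef_sum (type_ind 16) P).
Proof.
move=> hP; have := harm_coef_sum (type_ind 4) hP.
rewrite (eq_coef_sum hP.1 dual_laplacian_deg4) coef_sum_comb.
rewrite -!INRE -!RmultE -RplusE; set A := coef_sum _ _; set B := coef_sum _ _.
rewrite !INR_IZR_INZ /= -[0%R]/(IZR 0); lra.
Qed.

Lemma harm6_rel P : harm 6 P ->
  coef_sum (type_ind 20) P = Rmult (-15) (coef_sum (type_ind 36) P) /\
  coef_sum (type_ind 12) P = Rmult 30 (coef_sum (type_ind 36) P).
Proof.
move=> hP; have := harm_coef_sum (type_ind 16) hP; have := harm_coef_sum (type_ind 8) hP.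
rewrite (eq_coef_sum hP.1 dual_laplacian_deg6_type16) (eq_coef_sum hP.1 dual_laplacian_deg6_type8).
rewrite !coef_sum_comb -!INRE -!RmultE -!RplusE.
set A := coef_sum (type_ind 36) P; set B := coef_sum (type_ind 20) P.
set D := coef_sum (type_ind 12) P.
rewrite !INR_IZR_INZ /= -[0%R]/(IZR 0); lra.
Qed.

Lemma theta_sum_comb (s : nat -> C) d (L : seq (('X_{1..n} -> R) * C)) P :
  P \is d.-homog ->
  (forall m, mdeg m = d -> \big[Cmult/RtoC 1]_(l < n) s (m l) =
     \big[Cplus/RtoC 0]_(p <- L) Cmult (RtoC (p.1 m)) p.2) ->
  theta_sum s P = \big[Cplus/RtoC 0]_(p <- L) Cmult (RtoC (coef_sum p.1 P)) p.2.
Proof.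
move=> /dhomogP hP sL; rewrite /theta_sum /coef_sum big_seq.
transitivity (\big[Cplus/RtoC 0]_(m <- msupp P) \big[Cplus/RtoC 0]_(p <- L)
    Cmult (RtoC (P@_m * p.1 m)) p.2).
  rewrite [RHS]big_seq; apply: eq_bigr => m mP; rewrite sL; last exact: hP.
  by rewrite big_distrr /=; apply: eq_bigr => p _; rewrite CmultA -RtoC_mult.
rewrite exchange_big /=; apply: eq_bigr => p _.
by rewrite RtoC_sum big_distrl.
Qed.

Lemma prod_odd (s : nat -> C) m : (forall k, odd k -> s k = RtoC 0) -> ~~ even_mnm m ->
  \big[Cmult/RtoC 1]_(l < n) s (m l) = RtoC 0.
Proof.
move=> s0; rewrite negb_forall => /existsP[l]; rewrite negbK => odl.
by rewrite (bigD1 l) //= s0 // Cmult0.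
Qed.

Variables (s : nat -> C) (s_odd : forall k, odd k -> s k = RtoC 0).

Lemma theta_sum_deg2 P : P \is 2.-homog ->
  theta_sum s P = Cmult (RtoC (coef_sum (type_ind 4) P)) (Cmult (s 2) (Cpown (s 0) (n - 1))).
Proof.
move=> hP.
rewrite (theta_sum_comb (L := [:: (type_ind 4, Cmult (s 2) (Cpown (s 0) (n - 1)))]) hP).
  by rewrite big_seq1.
move=> m dm; rewrite big_seq1 /=; have [ev|od] := boolP (even_mnm m); last first.
  by rewrite prod_odd // type_ind_odd // Cmult0.
have zw := profile2 ev dm; rewrite (prod_zero_padded _ zw) (type_ind_zero_padded _ ev zw).
by rewrite !big_seq1 /= Cmult1.
Qed.

(** For [n < 2] the truncated exponent [n - 2] does no harm, since no monomial then has shape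
    (2,2). *)
Lemma theta_sum_deg4 P : P \is 4.-homog ->
  theta_sum s P =
  Cplus (Cmult (RtoC (coef_sum (type_ind 16) P)) (Cmult (s 4) (Cpown (s 0) (n - 1))))
    (Cmult (RtoC (coef_sum (type_ind 8) P))
      (Cmult (Cmult (s 2) (s 2)) (Cpown (s 0) (n - 2)))).
Proof.
move=> hP.
rewrite (theta_sum_comb (L := [:: (type_ind 16, Cmult (s 4) (Cpown (s 0) (n - 1)));
  (type_ind 8, Cmult (Cmult (s 2) (s 2)) (Cpown (s 0) (n - 2)))]) hP).
  by rewrite !(big_cons, big_nil) [Cplus _ (RtoC 0)]Cplus_0_r.
move=> m dm; rewrite !(big_cons, big_nil) /=.
have [ev|od] := boolP (even_mnm m); last first.
  by rewrite prod_odd // !type_ind_odd // !Cmult0 !Cplus0.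
have eb (b : bool) : RtoC (b%:R : R) = if b then RtoC 1 else RtoC 0 by case: b.
by case: (profile4 ev dm) => zw; rewrite (prod_zero_padded _ zw)
  !(type_ind_zero_padded _ ev zw) !eb !(big_cons, big_nil) /=; ring.
Qed.

Lemma theta_sum_deg6 P : P \is 6.-homog ->
  theta_sum s P =
  Cplus (Cmult (RtoC (coef_sum (type_ind 36) P)) (Cmult (s 6) (Cpown (s 0) (n - 1))))
   (Cplus (Cmult (RtoC (coef_sum (type_ind 20) P))
      (Cmult (Cmult (s 4) (s 2)) (Cpown (s 0) (n - 2))))
    (Cmult (RtoC (coef_sum (type_ind 12) P))
      (Cmult (Cmult (s 2) (Cmult (s 2) (s 2))) (Cpown (s 0) (n - 3))))).
Proof.
move=> hP.
rewrite (theta_sum_comb (L := [:: (type_ind 36, Cmult (s 6) (Cpown (s 0) (n - 1)));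
  (type_ind 20, Cmult (Cmult (s 4) (s 2)) (Cpown (s 0) (n - 2)));
  (type_ind 12, Cmult (Cmult (s 2) (Cmult (s 2) (s 2))) (Cpown (s 0) (n - 3)))]) hP).
  by rewrite !(big_cons, big_nil) [Cplus _ (RtoC 0)]Cplus_0_r.
move=> m dm; rewrite !(big_cons, big_nil) /=.
have [ev|od] := boolP (even_mnm m); last first.
  by rewrite prod_odd // !type_ind_odd // !Cmult0 !Cplus0.
have eb (b : bool) : RtoC (b%:R : R) = if b then RtoC 1 else RtoC 0 by case: b.
by case: (profile6 ev dm) => zw; rewrite (prod_zero_padded _ zw)
  !(type_ind_zero_padded _ ev zw) !eb !(big_cons, big_nil) /=; ring.
Qed.

End HarmonicRelations.

(** * Harmonic polynomials on which the linear forms do not vanish *)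

Section HarmonicExamples.
Local Open Scope ring_scope.
Import mathcomp.algebra_tactics.ring.
Variable n : nat.
Implicit Types (i j k l : 'I_n).

Definition mnm2 i j a b : 'X_{1..n} := (U_(i) *+ a + U_(j) *+ b)%MM.
Definition mnm3 i j k a b c : 'X_{1..n} := (U_(i) *+ a + U_(j) *+ b + U_(k) *+ c)%MM.

Lemma big_supp2 (T : Type) (idx : T) (op : Monoid.com_law idx) (F : 'I_n -> T) i j :
  i != j -> (forall l, l != i -> l != j -> F l = idx) ->
  \big[op/idx]_(l < n) F l = op (F i) (F j).
Proof.
move=> nij F0; rewrite (bigD1 i) //= (bigD1 j) 1?eq_sym //= big1 ?Monoid.mulm1 //.
by move=> l /andP[]; exact: F0.
Qed.

Lemma big_supp3 (T : Type) (idx : T) (op : Monoid.com_law idx) (F : 'I_n -> T) i j k :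
  i != j -> i != k -> j != k ->
  (forall l, l != i -> l != j -> l != k -> F l = idx) ->
  \big[op/idx]_(l < n) F l = op (F i) (op (F j) (F k)).
Proof.
move=> nij nik njk F0; rewrite (bigD1 i) //= (bigD1 j) 1?eq_sym //=.
rewrite (bigD1 k) ?(eq_sym k) ?nik ?njk //= big1 ?Monoid.mulm1 //.
by move=> l /andP[/andP[]]; exact: F0.
Qed.

Lemma mnm2E i j a b l : mnm2 i j a b l = ((i == l) * a + (j == l) * b)%N.
Proof. by rewrite mnmDE !mulmnE !mnm1E. Qed.
Lemma mnm3E i j k a b c l :
  mnm3 i j k a b c l = ((i == l) * a + (j == l) * b + (k == l) * c)%N.
Proof. by rewrite !mnmDE !mulmnE !mnm1E. Qed.

Lemma laplacianMn (P : {mpoly R[n]}) q : laplacian (P *+ q) = laplacian P *+ q.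
Proof. by rewrite -scaler_nat laplacianZ scaler_nat. Qed.
Lemma laplacianN (P : {mpoly R[n]}) : laplacian (- P) = - laplacian P.
Proof. by rewrite -scaleN1r laplacianZ scaleN1r. Qed.
Lemma coef_sumMn (f : 'X_{1..n} -> R) P q : coef_sum f (P *+ q) = coef_sum f P *+ q.
Proof. by rewrite -scaler_nat coef_sumZ mulr_natl. Qed.
Lemma coef_sumN (f : 'X_{1..n} -> R) P : coef_sum f (- P) = - coef_sum f P.
Proof. by rewrite -scaleN1r coef_sumZ mulN1r. Qed.

Section TwoVariables.
Variables (i j : 'I_n) (nij : i != j).
Local Notation M a b := 'X_[R, mnm2 i j a b].

Lemma laplacian_mnm2 a b : laplacian (M a b) =
  M (a - 2) b *+ (a * a.-1) + M a (b - 2) *+ (b * b.-1).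
Proof.
have nji : (j == i) = false by rewrite eq_sym (negbTE nij).
have ij := negbTE nij.
rewrite laplacianX (big_supp2 _ nij) => [|l li lj]; last first.
  by rewrite mnm2E ![_ == l]eq_sym (negbTE li) (negbTE lj) /= scale0r.
rewrite !mnm2E !eqxx ij nji mul0n !mul1n addn0 add0n !scaler_nat; congr (_ + _).
  case: a => [|[|a]]; rewrite ?mulr0n ?muln0 //; congr ('X_[_] *+ _).
  by apply/mnmP => l; rewrite mnmBE !mnm2E mulmnE mnm1E; lia.
case: b => [|[|b]]; rewrite ?mulr0n ?muln0 //; congr ('X_[_] *+ _).
by apply/mnmP => l; rewrite mnmBE !mnm2E mulmnE mnm1E; lia.
Qed.

Lemma type_ind_mnm2 t a b : ~~ odd a -> ~~ odd b ->
  type_ind t (mnm2 i j a b) = (a ^ 2 + b ^ 2 == t)%N%:R.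
Proof.
move=> ea eb; have nji : (j == i) = false by rewrite eq_sym (negbTE nij).
have ij := negbTE nij.
have ev : even_mnm (mnm2 i j a b).
  by apply/forallP => l; rewrite mnm2E; rewrite oddD !oddM (negbTE ea) (negbTE eb) !andbF.
rewrite /type_ind ev /mnm_sumsq (big_supp2 _ nij) => [|l li lj]; last first.
  by rewrite mnm2E ![_ == l]eq_sym (negbTE li) (negbTE lj).
by rewrite !mnm2E !eqxx ij nji !mul0n !mul1n addn0 add0n.
Qed.

Lemma harm4_example : exists P : {mpoly R[n]}, harm 4 P /\ coef_sum (type_ind 16) P = 2%:R.
Proof.
(* This is the real part of [(x + i y)^4]. *)
exists (M 4 0 - M 2 2 *+ 6 + M 0 4); split; last first.
  rewrite !(coef_sumN, coef_sumD, coef_sumMn, coef_sumX) !type_ind_mnm2 //.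
  transitivity ((1%:R : R) - (0%:R : R) *+ 6 + 1%:R)%R; first exact: erefl.
  by rewrite !(mulr0n, mul0rn, oppr0, addr0) -natrD.
split.
  have hX a b : (a + b = 4)%N -> M a b \is 4.-homog.
    by move=> ab; rewrite dhomogX /= mdegD !mdegMn !mdeg1 !mul1n ab.
  by rewrite rpredD ?rpredB ?rpredMn ?hX.
rewrite !(laplacianN, laplacianD, laplacianMn) !laplacian_mnm2 /=.
ring.
Qed.

End TwoVariables.

Section ThreeVariables.
Variables (i j k : 'I_n) (nij : i != j) (nik : i != k) (njk : j != k).
Local Notation M a b c := 'X_[R, mnm3 i j k a b c].

Let ij := negbTE nij.
Let ik := negbTE nik.
Let jk := negbTE njk.
Let ji : (j == i) = false. Proof. by rewrite eq_sym. Qed.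
Let ki : (k == i) = false. Proof. by rewrite eq_sym. Qed.
Let kj : (k == j) = false. Proof. by rewrite eq_sym. Qed.

Lemma laplacian_mnm3 a b c : laplacian (M a b c) =
  M (a - 2) b c *+ (a * a.-1) + M a (b - 2) c *+ (b * b.-1) + M a b (c - 2) *+ (c * c.-1).
Proof.
rewrite laplacianX (big_supp3 _ nij nik njk) => [|l li lj lk]; last first.
  by rewrite mnm3E ![_ == l]eq_sym (negbTE li) (negbTE lj) (negbTE lk) /= scale0r.
rewrite !mnm3E !eqxx ij ik jk ji ki kj !mul0n !mul1n !addn0 !add0n !scaler_nat.
rewrite -addrA; congr (_ + (_ + _)).
- case: a => [|[|a]]; rewrite ?mulr0n ?muln0 //; congr ('X_[_] *+ _).
  by apply/mnmP => l; rewrite mnmBE !mnm3E mulmnE mnm1E; lia.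
- case: b => [|[|b]]; rewrite ?mulr0n ?muln0 //; congr ('X_[_] *+ _).
  by apply/mnmP => l; rewrite mnmBE !mnm3E mulmnE mnm1E; lia.
- case: c => [|[|c]]; rewrite ?mulr0n ?muln0 //; congr ('X_[_] *+ _).
  by apply/mnmP => l; rewrite mnmBE !mnm3E mulmnE mnm1E; lia.
Qed.

Lemma type_ind_mnm3 t a b c : ~~ odd a -> ~~ odd b -> ~~ odd c ->
  type_ind t (mnm3 i j k a b c) = (a ^ 2 + (b ^ 2 + c ^ 2) == t)%N%:R.
Proof.
move=> ea eb ec.
have ev : even_mnm (mnm3 i j k a b c).
  by apply/forallP => l; rewrite mnm3E; rewrite !oddD !oddM (negbTE ea) (negbTE eb) (negbTE ec) !andbF.
rewrite /type_ind ev /mnm_sumsq (big_supp3 _ nij nik njk) => [|l li lj lk]; last first.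
  by rewrite mnm3E ![_ == l]eq_sym (negbTE li) (negbTE lj) (negbTE lk).
by rewrite !mnm3E !eqxx ij ik jk ji ki kj !mul0n !mul1n !addn0 !add0n.
Qed.

Lemma harm6_example : exists P : {mpoly R[n]}, harm 6 P /\ coef_sum (type_ind 36) P = 6%:R.
Proof.
(* A symmetric ansatz: for leading sum [3 * 2 = 6], [harm6_rel] requires the six middle coefficients
   to total -90 and the last to be 180. *)
exists ((M 6 0 0 + M 0 6 0 + M 0 0 6) *+ 2
  - (M 4 2 0 + M 4 0 2 + M 2 4 0 + M 0 4 2 + M 2 0 4 + M 0 2 4) *+ 15
  + M 2 2 2 *+ 180); split; last first.
  rewrite !(coef_sumN, coef_sumD, coef_sumMn, coef_sumX) !type_ind_mnm3 //.
  transitivity (((1%:R : R) + 1%:R + 1%:R) *+ 2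
    - (0%:R + 0%:R + 0%:R + 0%:R + 0%:R + 0%:R) *+ 15
    + 0%:R *+ 180); first exact: erefl.
  by rewrite !(mulr0n, mul0rn, oppr0, addr0) -!natrD -mulrnA.
split.
  have hX a b c : (a + b + c = 6)%N -> M a b c \is 6.-homog.
    by move=> abc; rewrite dhomogX /= !mdegD !mdegMn !mdeg1 !mul1n abc.
  by rewrite rpredD ?rpredB ?rpredMn ?rpredD ?hX.
rewrite !(laplacianN, laplacianD, laplacianMn) !laplacian_mnm3 /=.
ring.
Qed.

End ThreeVariables.
End HarmonicExamples.

(** * The four assertions and the exact dimensions in which the forms vanish *)

Theorem lemma9p1 (n : nat) (hn : (1 <= n)%N) :
  (* Theta_{Z^n} = theta_3^n *)
  (forall z : C, (Rlt 0 (Im z)) ->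
     Znsum_to (thetaZn_term (1%R : {mpoly R[n]}) z) (Cpown (theta3 z) n))
  /\
  (* Theta_{Z^n,P} = 0 for P in Harm_2 *)
  (forall P : {mpoly R[n]}, harm 2 P ->
     forall z : C, (Rlt 0 (Im z)) -> Znsum_to (thetaZn_term P z) (RtoC 0))
  /\
  (* degree 4 *)
  (exists c1 : {mpoly R[n]} -> R,
     linear_on (harm 4) c1 /\
     (forall P : {mpoly R[n]}, harm 4 P ->
        forall z : C, (Rlt 0 (Im z)) ->
          Znsum_to (thetaZn_term P z)
            (Cmult (RtoC (c1 P)) (Cmult (Delta8 z) (Cpown (theta3 z) n)))) /\
     ((exists P : {mpoly R[n]}, harm 4 P /\ c1 P <> 0%R) <-> (2 <= n)%N))
  /\
  (* degree 6 *)
  (exists c2 : {mpoly R[n]} -> R,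
     linear_on (harm 6) c2 /\
     (forall P : {mpoly R[n]}, harm 6 P ->
        forall z : C, (Rlt 0 (Im z)) ->
          Znsum_to (thetaZn_term P z)
            (Cmult (RtoC (c2 P))
               (Cmult (varphi z) (Cmult (Delta8 z) (Cpown (theta3 z) n))))) /\
     ((exists P : {mpoly R[n]}, harm 6 P /\ c2 P <> 0%R) <-> (3 <= n)%N)).
Proof.
(* Without monomials of shape (2,2), [harm4_rel] reads [0 = -3 A]; [small6] uses [0 = 30 A] in the
   same way. *)
have small4 (P : {mpoly R[n]}) : (n < 2)%N -> harm 4 P -> coef_sum (type_ind 16) P = IZR 0.
  move=> n2 hP; have := harm4_rel hP.
  rewrite (eq_coef_sum hP.1 (j := fun=> 0%R) (fun m => type_ind8_small n2)).
  rewrite {1}/coef_sum big1 => [|m _]; last by rewrite mulr0.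
  by rewrite -[0%R]/(IZR 0); lra.
have small6 (P : {mpoly R[n]}) : (n < 3)%N -> harm 6 P -> coef_sum (type_ind 36) P = IZR 0.
  move=> n3 hP; have [_] := harm6_rel hP.
  rewrite (eq_coef_sum hP.1 (j := fun=> 0%R) (fun m => type_ind12_small n3)).
  rewrite {1}/coef_sum big1 => [|m _]; last by rewrite mulr0.
  by rewrite -[0%R]/(IZR 0); lra.
split; [|split; [|split]].
- move=> z hz; rewrite theta3_ev //.
  have -> : Cpown (moment z 0) n = theta_sum (moment z) (1%R : {mpoly R[n]}).
    rewrite /theta_sum msupp1 big_seq1 mcoeff1 eqxx Cmult1.
    under eq_bigr => i _ do rewrite mnm0E.
    by rewrite big_Cmult_const card_ord.
  exact: Znsum_theta.
- move=> P hP z hz; have := @Znsum_theta n z hz P.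
  by rewrite (theta_sum_deg2 (moment_odd hz) hP.1) (harm2_rel hP) Cmult0.
(* Twice the sum of the coefficients of the pure fourth powers; the 2 is that of
   [moment_degree4]. *)
- exists (fun P => Rmult 2 (coef_sum (type_ind 16) P)); split; [|split].
  + move=> a P Q _ _; rewrite coef_sum_linear -RmultE -RplusE; ring.
  + move=> P hP z hz; have := @Znsum_theta n z hz P; rewrite theta3_ev //.
    rewrite (theta_sum_deg4 (moment_odd hz) hP.1); congr (Znsum_to _ _).
    (* For [n = 1] both sides vanish; otherwise [n = k + 2], and [s 0 ^ k] can be factored out
       before [moment_degree4] applies. *)
    have [n2|n2] := ltnP n 2.
      rewrite (harm4_rel hP) (small4 P n2 hP) !Rmult_0_r !Cmult0; ring.
    rewrite (harm4_rel hP); move: (coef_sum _ _) => A; move: n2 => /subnK <-; move: (n - 2)%N => k.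
    have := moment_degree4 hz; set s := moment z => E.
    have -> : (k + 2 - 1 = k.+1)%N by lia.
    have -> : (k + 2 - 2 = k)%N by lia.
    rewrite addn2 !CpownS (RtoC_mult (-3)) (RtoC_mult 2).
    have -> : RtoC (-3) = Copp (RtoC 3) by rewrite -RtoC_opp; congr RtoC; lra.
    transitivity (Cmult (Cmult (RtoC A) (Cpown (s 0%N) k))
      (Cminus (Cmult (s 4%N) (s 0%N)) (Cmult (RtoC 3) (Cmult (s 2%N) (s 2%N))))); first by ring.
    by rewrite E; ring.
  + split=> [[P [hP cP]]|n2].
      rewrite leqNgt; apply/negP => n2; apply: cP.
      by rewrite (small4 P n2 hP) Rmult_0_r.
    have nij : Ordinal hn != Ordinal n2 by [].
    have [P [hP cP]] := harm4_example nij; exists P; split=> //; rewrite cP -INRE /=.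
    by rewrite -[0%R]/(IZR 0); lra.
- exists (fun P => Rmult 2 (coef_sum (type_ind 36) P)); split; [|split].
  + move=> a P Q _ _; rewrite coef_sum_linear -RmultE -RplusE; ring.
  + move=> P hP z hz; have := @Znsum_theta n z hz P; rewrite theta3_ev //.
    have [r1 r2] := harm6_rel hP.
    rewrite (theta_sum_deg6 (moment_odd hz) hP.1); congr (Znsum_to _ _).
    have [n3|n3] := ltnP n 3.
      rewrite r1 r2 (small6 P n3 hP) !Rmult_0_r !Cmult0; ring.
    rewrite r1 r2; move: (coef_sum _ _) => A; move: n3 => /subnK <-; move: (n - 3)%N => k.
    have := moment_degree6 hz; set s := moment z => E.
    have -> : (k + 3 - 1 = k.+2)%N by lia.
    have -> : (k + 3 - 2 = k.+1)%N by lia.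
    have -> : (k + 3 - 3 = k)%N by lia.
    rewrite addn3 !CpownS (RtoC_mult (-15)) (RtoC_mult 30) (RtoC_mult 2).
    have -> : RtoC (-15) = Copp (RtoC 15) by rewrite -RtoC_opp; congr RtoC; lra.
    transitivity (Cmult (Cmult (RtoC A) (Cpown (s 0%N) k))
      (Cplus (Cminus (Cmult (s 6%N) (Cmult (s 0%N) (s 0%N)))
        (Cmult (RtoC 15) (Cmult (s 4%N) (Cmult (s 2%N) (s 0%N)))))
        (Cmult (RtoC 30) (Cmult (s 2%N) (Cmult (s 2%N) (s 2%N)))))); first by ring.
    by rewrite E; ring.
  + split=> [[P [hP cP]]|n3].
      rewrite leqNgt; apply/negP => n3; apply: cP.
      by rewrite (small6 P n3 hP) Rmult_0_r.
    have n2 : (1 < n)%N by apply: ltnW.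
    have nij : Ordinal hn != Ordinal n2 by [].
    have nik : Ordinal hn != Ordinal n3 by [].
    have njk : Ordinal n2 != Ordinal n3 by [].
    have [P [hP cP]] := harm6_example nij nik njk; exists P; split=> //; rewrite cP -INRE.
    by rewrite INR_IZR_INZ /= -[0%R]/(IZR 0); lra.
Qed.
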